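(* Let $n\ge 3$, let $(V,l,r,\alpha_V)$ be a representation of a Hom-pre-Lie superalgebra $(\mathcal{A},\circ,\alpha)$, and let $\Phi:\mathcal{A}\times\cdots\times\mathcal{A}\to\mathbb{K}$ be an even super-skew-symmetric $(n-2)$-linear form such that (i) $\Phi(x_1,\dots,x_i,\,y\circ z,\,x_{i+1},\dots,x_{n-3})=0$ for all homogeneous $x_1,\dots,x_{n-3},y,z\in\mathcal{A}$ and all positions of $y\circ z$; (ii) $\Phi(\alpha(x_1),x_2,\dots,x_{n-2})=\Phi(x_1,\dots,x_{n-2})$ for all $x_i\in\mathcal{A}$; (iii) $\sum_{k=1}^{n-1}(-1)^{k+1}(-1)^{|y_k||Y|_{k+1}^{n-1}}\Phi(y_1,\dots,\widehat{y_k},\dots,y_{n-1})\Phi(x_1,\dots,x_{n-3},y_k)=0$ for all homogeneous $x_i,y_j\in\mathcal{A}$. Let $(\mathcal{A},\{\cdot,\dots,\cdot\}_\Phi,\alpha)$ be the $n$-Hom-pre-Lie superalgebra with product $$\{x_1,\dots,x_n\}_\Phi=\sum_{k=1}^{n-1}(-1)^{k+1}(-1)^{|x_k||X|_{k+1}^{n-1}}\Phi(x_1,\dots,\widehat{x_k},\dots,x_{n-1})(x_k\circ x_n).$$ Then $(V,l_\Phi,r_\Phi,\alpha_V)$ is a representation of $(\mathcal{A},\{\cdot,\dots,\cdot\}_\Phi,\alpha)$, where $$l_\Phi(x_1,\dots,x_{n-1})=\sum_{k=1}^{n-1}(-1)^{k+1}(-1)^{|x_k||X|_{k+1}^{n-1}}\Phi(x_1,\dots,\widehat{x_k},\dots,x_{n-1})\,l(x_k),$$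 $$r_\Phi(x_1,\dots,x_{n-1})=\Phi(x_1,\dots,x_{n-2})\,r(x_{n-1}).$$
   Context: Conventions. $\mathbb{K}$ is an algebraically closed field of characteristic $0$; all vector spaces are over $\mathbb{K}$ and $\mathbb{Z}_2$-graded. $|x|$ is the degree of a homogeneous element; formulas involving degrees are for homogeneous elements. For a tuple $X=(x_1,x_2,\dots)$ put $|X|_i^j=\sum_{k=i}^j|x_k|$ (zero if $j<i$), similarly for $Y$. A hat means omission. A (multi)linear map is even if it preserves degree; a form $\Phi$ is even if it vanishes on homogeneous arguments of odd total degree. Super-skew-symmetric in some consecutive arguments: exchanging adjacent $x_i,x_{i+1}$ among them multiplies the value by $-(-1)^{|x_i||x_{i+1}|}$. $gl(V)$ is the space of linear endomorphisms of $V$ with its natural grading. Hom-pre-Lie superalgebra: $(\mathcal{A},\circ,\alpha)$ with $\circ$ even bilinear, $\alpha$ even linear, $\mathfrak{ass}(x,y,z)=(-1)^{|x||y|}\mathfrak{ass}(y,x,z)$ where $\mathfrak{ass}(x,y,z)=\alpha(x)\circ(y\circ z)-(x\circ y)\circ\alpha(z)$. Put $[x,y]^C=x\circ y-(-1)^{|x||y|}y\circ x$. A representation of it is $(V,l,r,\alpha_V)$ with $l,r:\mathcal{A}\to gl(V)$ even linear and $\alpha_V:V\to V$ even linear such that $\alpha_Vl(x)=l(\alpha(x))\alpha_V$; $\alpha_Vr(x)=r(\alpha(x))\alpha_V$; $l([x,y]^C)\alpha_V=l(\alpha(x))l(y)-(-1)^{|x||y|}l(\alpha(y))l(x)$; $r(\alpha(y))r(x)-(-1)^{|x||y|}r(x\circ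 y)\alpha_V=r(\alpha(y))l(x)-(-1)^{|x||y|}l(\alpha(x))r(y)$. $n$-Hom-pre-Lie superalgebra: $(\mathcal{A},\{\cdot,\dots,\cdot\},\alpha)$ with $\{\cdot,\dots,\cdot\}$ even $n$-linear, super-skew-symmetric in the first $n-1$ arguments, and $\alpha$ even linear such that, with $X=(x_1,\dots,x_{n-1})$, $|X|=|X|_1^{n-1}$, $$\{\alpha(x_1),\dots,\alpha(x_{n-1}),\{y_1,\dots,y_n\}\}=\sum_{i=1}^{n-1}(-1)^{|X||Y|_1^{i-1}}\{\alpha(y_1),\dots,[x_1,\dots,x_{n-1},y_i]^C,\dots,\alpha(y_n)\}+(-1)^{|X||Y|_1^{n-1}}\{\alpha(y_1),\dots,\alpha(y_{n-1}),\{x_1,\dots,x_{n-1},y_n\}\},$$ $$\{[x_1,\dots,x_n]^C,\alpha(y_1),\dots,\alpha(y_{n-1})\}=\sum_{i=1}^n(-1)^{n-i}(-1)^{|x_i||X|_{i+1}^n}\{\alpha(x_1),\dots,\widehat{\alpha(x_i)},\dots,\alpha(x_n),\{x_i,y_1,\dots,y_{n-1}\}\},$$ where $[x_1,\dots,x_n]^C=\sum_{i=1}^n(-1)^{n-i}(-1)^{|x_i||X|_{i+1}^n}\{x_1,\dots,\widehat{x_i},\dots,x_n,x_i\}$ (with bracket $[\cdot,\dots,\cdot]^C$ and map $\alpha$, $\mathcal{A}$ is called the sub-adjacent $n$-Hom-Lie superalgebra $\mathcal{A}^c$). Representation of $\mathcal{A}^c$ on $V$: an even super-skew-symmetric $(n-1)$-linear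 map $l:\mathcal{A}^{n-1}\to gl(V)$ and an even linear $\alpha_V:V\to V$ with (a) $l(\alpha(x_1),\dots,\alpha(x_{n-1}))\alpha_V=\alpha_Vl(x_1,\dots,x_{n-1})$; (b) $l(\alpha(x_1),\dots,\alpha(x_{n-1}))l(y_1,\dots,y_{n-1})-(-1)^{|X|_1^{n-1}|Y|_1^{n-1}}l(\alpha(y_1),\dots,\alpha(y_{n-1}))l(x_1,\dots,x_{n-1})=\sum_{i=1}^{n-1}(-1)^{|X|_1^{n-1}|Y|_1^{i-1}}l(\alpha(y_1),\dots,[x_1,\dots,x_{n-1},y_i]^C,\dots,\alpha(y_{n-1}))\alpha_V$; (c) $l(\alpha(x_1),\dots,\alpha(x_{n-2}),[y_1,\dots,y_n]^C)\alpha_V=\sum_{i=1}^n(-1)^{n-i}(-1)^{|X|_1^{n-2}(|Y|_1^n+|y_i|)+|y_i||Y|_{i+1}^n}l(\alpha(y_1),\dots,\widehat{\alpha(y_i)},\dots,\alpha(y_n))l(x_1,\dots,x_{n-2},y_i)$. Representation of the $n$-Hom-pre-Lie superalgebra: $(V,l,r,\alpha_V)$ where $(V,l,\alpha_V)$ is a representation of $\mathcal{A}^c$, and $r:\mathcal{A}^{n-1}\to gl(V)$ is even $(n-1)$-linear, super-skew-symmetric in its first $n-2$ arguments, such that, with $\mu(x_1,\dots,x_{n-1})=l(x_1,\dots,x_{n-1})+\sum_{i=1}^{n-1}(-1)^i(-1)^{|x_i||X|_{i+1}^{n-1}}r(x_1,\dots,\widehat{x_i},\dots,x_{n-1},x_i)$,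 (R1) $\alpha_Vr(x_1,\dots,x_{n-1})=r(\alpha(x_1),\dots,\alpha(x_{n-1}))\alpha_V$; (R2) $l(\alpha(x_1),\dots,\alpha(x_{n-1}))r(y_1,\dots,y_{n-1})=(-1)^{|X|_1^{n-1}|Y|_1^{n-1}}r(\alpha(y_1),\dots,\alpha(y_{n-1}))\mu(x_1,\dots,x_{n-1})+\sum_{i=1}^{n-2}(-1)^{|X|_1^{n-1}|Y|_1^{i-1}}r(\alpha(y_1),\dots,[x_1,\dots,x_{n-1},y_i]^C,\dots,\alpha(y_{n-1}))\alpha_V+(-1)^{|X|_1^{n-1}|Y|_1^{n-2}}r(\alpha(y_1),\dots,\alpha(y_{n-2}),\{x_1,\dots,x_{n-1},y_{n-1}\})\alpha_V$; (R3) $r([x_1,\dots,x_n]^C,\alpha(y_1),\dots,\alpha(y_{n-2}))\alpha_V=\sum_{i=1}^n(-1)^{n-i}(-1)^{|x_i||X|_{i+1}^n}l(\alpha(x_1),\dots,\widehat{\alpha(x_i)},\dots,\alpha(x_n))r(x_i,y_1,\dots,y_{n-2})$; (R4) $r(\alpha(x_1),\dots,\alpha(x_{n-2}),\{y_1,\dots,y_n\})\alpha_V=(-1)^{|X|_1^{n-2}|Y|_1^{n-1}}l(\alpha(y_1),\dots,\alpha(y_{n-1}))r(x_1,\dots,x_{n-2},y_n)+\sum_{i=1}^{n-1}(-1)^{n-i}(-1)^{(|X|_1^{n-2}+|y_i|)|Y|_{i+1}^n+|X|_1^{n-2}|Y|_1^{i-1}}r(\alpha(y_1),\dots,\widehat{\alpha(y_i)},\dots,\alpha(y_n))\mu(x_1,\dots,x_{n-2},y_i)$;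 (R5) $r(\alpha(y_1),\dots,\alpha(y_{n-1}))\mu(x_1,\dots,x_{n-1})=(-1)^{|X|_1^{n-1}|Y|_1^{n-1}}\Big(l(\alpha(x_1),\dots,\alpha(x_{n-1}))r(y_1,\dots,y_{n-1})+\sum_{i=1}^{n-1}(-1)^i(-1)^{|x_i||X|_{i+1}^{n-1}}r(\alpha(x_1),\dots,\widehat{\alpha(x_i)},\dots,\alpha(x_{n-1}),\{x_i,y_1,\dots,y_{n-1}\})\alpha_V\Big)$. *)

(* Defs.v *)
From HB Require Import structures.
From mathcomp Require Import all_boot all_order all_algebra all_fingroup.

Set Implicit Arguments.
Unset Strict Implicit.
Unset Printing Implicit Defensive.

Import GRing.Theory.
Local Open Scope ring_scope.

(* The decomposition V = V_0 (+) V_1 is given by its two projections; the     *)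
(* degree [true] is the odd one.                                              *)
HB.mixin Record isSuper (K : fieldType) V of GRing.Lmodule K V := {
  hpart : bool -> V -> V;
  hpart_linear : forall d, linear (hpart d);
  hpartK : forall d e v, hpart d (hpart e v) = if d == e then hpart e v else 0;
  hpart_sum : forall v, hpart false v + hpart true v = v
}.

#[short(type="superType")]
HB.structure Definition Super (K : fieldType) :=
  {V of GRing.Lmodule K V & isSuper K V}.

(* [homog d v] reads v \in V_d. Identities involving degrees quantify over all *)
(* d with [homog d v], so that 0 is allowed either degree.                    *)
Definition homog (K : fieldType) (V : superType K) (d : bool) (v : V) : Prop :=
  hpart d v = v.

Definition homogs (K : fieldType) (V : superType K) m
    (d : 'I_m -> bool) (x : 'I_m -> V) : Prop :=
  forall i, homog (d i) (x i).

(* Indices start at 0: |X|_(a+1)^b = dsum d a b, where d lists the degrees.   *)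
Definition dsum m (d : 'I_m -> bool) (a b : nat) : nat :=
  (\sum_(k < m | a <= k < b) d k)%N.

Section Tuples.
Variables (T : Type) (n : nat).

Definition omit (x : 'I_n -> T) (k : 'I_n) : 'I_n.-1 -> T :=
  fun j => x (lift k j).

Definition set_arg (x : 'I_n -> T) (k : 'I_n) (a : T) : 'I_n -> T :=
  fun j => if j == k then a else x j.

(* (x_1, .., a, .., x_(n-1)) with a at position k *)
Definition insert_arg (x : 'I_n.-1 -> T) (k : 'I_n) (a : T) : 'I_n -> T :=
  fun j => oapp x a (unlift k j).

(* (a, x_1, .., x_(n-1)) *)
Definition cons_arg (a : T) (x : 'I_n.-1 -> T) : 'I_n -> T :=
  fun j => if (j : nat) is k.+1 then oapp x a (insub k) else a.

(* (x_1, .., x_(n-1), a) *)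
Definition snoc_arg (x : 'I_n.-1 -> T) (a : T) : 'I_n -> T :=
  fun j => oapp x a (insub (j : nat)).

End Tuples.

Section Maps.
Variable K : fieldType.

Definition multilinear m (U W : lmodType K) (f : ('I_m -> U) -> W) : Prop :=
  forall x i, linear (fun u => f (set_arg x i u)).

Definition super_skew m (A : superType K) (W : lmodType K)
    (f : ('I_m -> A) -> W) : Prop :=
  forall (d : 'I_m -> bool) (x : 'I_m -> A) (i j : 'I_m),
    homogs d x -> j = i.+1 :> nat ->
    f (fun k => x (tperm i j k)) = - ((-1) ^+ (d i * d j)%N *: f x).

Definition even_map (A B : superType K) (f : A -> B) : Prop :=
  forall d x, homog d x -> homog d (f x).

Definition even_form m (A : superType K) (Phi : ('I_m -> A) -> K) : Prop :=
  forall (d : 'I_m -> bool) (x : 'I_m -> A),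
    homogs d x -> odd (dsum d 0 m) -> Phi x = 0.

(* Extends a formula F d x, meant for homogeneous x_i of degrees d_i, to all  *)
(* arguments by additivity over their homogeneous components.                 *)
Definition hext m (A : superType K) (W : lmodType K)
    (F : ('I_m -> bool) -> ('I_m -> A) -> W) (x : 'I_m -> A) : W :=
  \sum_(d : {ffun 'I_m -> bool}) F d (fun i => hpart (d i) (x i)).

End Maps.

Section HomPreLie.
Variables (K : fieldType) (A V : superType K).
Variables (mul : A -> A -> A) (alpha : A -> A).
Variables (l r : A -> V -> V) (alphaV : V -> V).

Definition hom_ass (x y z : A) : A :=
  mul (alpha x) (mul y z) - mul (mul x y) (alpha z).

Definition comm2 (x y : A) : A :=
  mul x y - \sum_(a : bool) \sum_(b : bool)
              (-1) ^+ (a * b)%N *: mul (hpart b y) (hpart a x).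

Record hom_pre_lie : Prop := HomPreLie {
  hpl_linearl : forall y, linear (mul^~ y);
  hpl_linearr : forall x, linear (mul x);
  hpl_even : forall a b x y,
    homog a x -> homog b y -> homog (a (+) b) (mul x y);
  hpl_alpha_linear : linear alpha;
  hpl_alpha_even : even_map alpha;
  hpl_ass : forall a b c x y z, homog a x -> homog b y -> homog c z ->
    hom_ass x y z = (-1) ^+ (a * b)%N *: hom_ass y x z
}.

(* A linear map l : A -> gl(V) is curried: l x v. Evenness of l means that    *)
(* l x has degree |x| as an endomorphism.                                     *)
Record hom_pre_lie_rep : Prop := HomPreLieRep {
  hplr_l_linear : forall v, linear (l^~ v);
  hplr_l_gl : forall x, linear (l x);
  hplr_l_even : forall a b x v,
    homog a x -> homog b v -> homog (a (+) b) (l x v);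
  hplr_r_linear : forall v, linear (r^~ v);
  hplr_r_gl : forall x, linear (r x);
  hplr_r_even : forall a b x v,
    homog a x -> homog b v -> homog (a (+) b) (r x v);
  hplr_alphaV_linear : linear alphaV;
  hplr_alphaV_even : even_map alphaV;
  hplr_alphaV_l : forall x v, alphaV (l x v) = l (alpha x) (alphaV v);
  hplr_alphaV_r : forall x v, alphaV (r x v) = r (alpha x) (alphaV v);
  hplr_l : forall a b x y v, homog a x -> homog b y ->
    l (comm2 x y) (alphaV v) =
      l (alpha x) (l y v) - (-1) ^+ (a * b)%N *: l (alpha y) (l x v);
  hplr_r : forall a b x y v, homog a x -> homog b y ->
    r (alpha y) (r x v) - (-1) ^+ (a * b)%N *: r (mul x y) (alphaV v) =
      r (alpha y) (l x v) - (-1) ^+ (a * b)%N *: l (alpha x) (r y v)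
}.

End HomPreLie.

(* An n-linear map that is super-skew-symmetric in its first n-1 arguments is *)
(* taken with its last argument separated: br x z = {x_1, .., x_(n-1), z}.    *)
Section NHomPreLie.
Variables (K : fieldType) (n : nat) (A : superType K).
Variables (br : ('I_n.-1 -> A) -> A -> A) (alpha : A -> A).

Definition ncomm : ('I_n -> A) -> A := hext (fun d x =>
  \sum_(i < n) ((-1) ^+ (n.-1 - i)%N * (-1) ^+ (d i * dsum d i.+1 n)%N) *:
    br (omit x i) (x i)).

Record n_hom_pre_lie : Prop := NHomPreLie {
  nhpl_multilinear : forall z, multilinear (br^~ z);
  nhpl_linear : forall x, linear (br x);
  nhpl_even : forall d c x z, homogs d x -> homog c z ->
    homog (odd (dsum d 0 n.-1 + c)) (br x z);
  nhpl_skew : forall z, super_skew (br^~ z);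
  nhpl_alpha_linear : linear alpha;
  nhpl_alpha_even : even_map alpha;
  nhpl_br_br : forall (d e : 'I_n.-1 -> bool) (c : bool)
      (x y : 'I_n.-1 -> A) (z : A),
    homogs d x -> homogs e y -> homog c z ->
    br (alpha \o x) (br y z) =
      \sum_(i < n.-1) (-1) ^+ (dsum d 0 n.-1 * dsum e 0 i)%N *:
        br (set_arg (alpha \o y) i (ncomm (snoc_arg x (y i)))) (alpha z)
      + (-1) ^+ (dsum d 0 n.-1 * dsum e 0 n.-1)%N *:
        br (alpha \o y) (br x z);
  nhpl_comm_br : forall (d : 'I_n -> bool) (e : 'I_n.-2 -> bool) (c : bool)
      (x : 'I_n -> A) (y : 'I_n.-2 -> A) (z : A),
    homogs d x -> homogs e y -> homog c z ->
    br (cons_arg (ncomm x) (alpha \o y)) (alpha z) =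
      \sum_(i < n) ((-1) ^+ (n.-1 - i)%N * (-1) ^+ (d i * dsum d i.+1 n)%N) *:
        br (alpha \o omit x i) (br (cons_arg (x i) y) z)
}.

End NHomPreLie.

Section NHomLieRep.
Variables (K : fieldType) (n : nat) (A V : superType K).
Variables (lie : ('I_n -> A) -> A) (alpha : A -> A).
Variables (l : ('I_n.-1 -> A) -> V -> V) (alphaV : V -> V).

Record n_hom_lie_rep : Prop := NHomLieRep {
  nhlr_multilinear : forall v, multilinear (l^~ v);
  nhlr_gl : forall x, linear (l x);
  nhlr_even : forall d c x v, homogs d x -> homog c v ->
    homog (odd (dsum d 0 n.-1 + c)) (l x v);
  nhlr_skew : forall v, super_skew (l^~ v);
  nhlr_alphaV_linear : linear alphaV;
  nhlr_alphaV_even : even_map alphaV;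
  nhlr_alphaV_l : forall x v, l (alpha \o x) (alphaV v) = alphaV (l x v);
  nhlr_comm : forall (d e : 'I_n.-1 -> bool) (x y : 'I_n.-1 -> A) (v : V),
    homogs d x -> homogs e y ->
    l (alpha \o x) (l y v)
      - (-1) ^+ (dsum d 0 n.-1 * dsum e 0 n.-1)%N *: l (alpha \o y) (l x v) =
    \sum_(i < n.-1) (-1) ^+ (dsum d 0 n.-1 * dsum e 0 i)%N *:
      l (set_arg (alpha \o y) i (lie (snoc_arg x (y i)))) (alphaV v);
  nhlr_lie : forall (d : 'I_n.-2 -> bool) (e : 'I_n -> bool)
      (x : 'I_n.-2 -> A) (y : 'I_n -> A) (v : V),
    homogs d x -> homogs e y ->
    l (snoc_arg (alpha \o x) (lie y)) (alphaV v) =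
    \sum_(i < n)
      ((-1) ^+ (n.-1 - i)%N *
       (-1) ^+ (dsum d 0 n.-2 * (dsum e 0 n + e i)
                + e i * dsum e i.+1 n)%N) *:
      l (alpha \o omit y i) (l (snoc_arg x (y i)) v)
}.

End NHomLieRep.

(* As for br, the last argument of r is separated:                            *)
(* r x z = r(x_1, .., x_(n-2), z). The identity [nhplr_comm], where the first *)
(* and the last argument of r are distinct ones, presupposes 3 <= n.          *)
Section NHomPreLieRep.
Variables (K : fieldType) (n : nat) (A V : superType K).
Variables (br : ('I_n.-1 -> A) -> A -> A) (alpha : A -> A).
Variables (l : ('I_n.-1 -> A) -> V -> V) (r : ('I_n.-2 -> A) -> A -> V -> V).
Variables (alphaV : V -> V).

Definition mu (x : 'I_n.-1 -> A) (v : V) : V :=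
  l x v + hext (fun d y =>
    \sum_(i < n.-1) ((-1) ^+ i.+1 * (-1) ^+ (d i * dsum d i.+1 n.-1)%N) *:
      r (omit y i) (y i) v) x.

Record n_hom_pre_lie_rep : Prop := NHomPreLieRep {
  nhplr_l : n_hom_lie_rep (ncomm br) alpha l alphaV;
  nhplr_r_multilinear : forall z v, multilinear (fun x => r x z v);
  nhplr_r_linear : forall x v, linear (fun z => r x z v);
  nhplr_r_gl : forall x z, linear (r x z);
  nhplr_r_even : forall d b c x z v, homogs d x -> homog b z -> homog c v ->
    homog (odd (dsum d 0 n.-2 + b + c)) (r x z v);
  nhplr_r_skew : forall z v, super_skew (fun x => r x z v);
  nhplr_alphaV_r : forall x z v,
    alphaV (r x z v) = r (alpha \o x) (alpha z) (alphaV v);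
  nhplr_l_r : forall (d : 'I_n.-1 -> bool) (e : 'I_n.-2 -> bool) (c : bool)
      (x : 'I_n.-1 -> A) (y : 'I_n.-2 -> A) (z : A) (v : V),
    homogs d x -> homogs e y -> homog c z ->
    l (alpha \o x) (r y z v) =
      (-1) ^+ (dsum d 0 n.-1 * (dsum e 0 n.-2 + c))%N *:
        r (alpha \o y) (alpha z) (mu x v)
      + \sum_(i < n.-2) (-1) ^+ (dsum d 0 n.-1 * dsum e 0 i)%N *:
        r (set_arg (alpha \o y) i (ncomm br (snoc_arg x (y i))))
          (alpha z) (alphaV v)
      + (-1) ^+ (dsum d 0 n.-1 * dsum e 0 n.-2)%N *:
        r (alpha \o y) (br x z) (alphaV v);
  nhplr_comm : forall (d : 'I_n -> bool) (e : 'I_n.-2.-1 -> bool) (c : bool)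
      (x : 'I_n -> A) (y : 'I_n.-2.-1 -> A) (z : A) (v : V),
    homogs d x -> homogs e y -> homog c z ->
    r (cons_arg (ncomm br x) (alpha \o y)) (alpha z) (alphaV v) =
      \sum_(i < n) ((-1) ^+ (n.-1 - i)%N * (-1) ^+ (d i * dsum d i.+1 n)%N) *:
        l (alpha \o omit x i) (r (cons_arg (x i) y) z v);
  nhplr_br : forall (d : 'I_n.-2 -> bool) (e : 'I_n.-1 -> bool) (c : bool)
      (x : 'I_n.-2 -> A) (y : 'I_n.-1 -> A) (z : A) (v : V),
    homogs d x -> homogs e y -> homog c z ->
    r (alpha \o x) (br y z) (alphaV v) =
      (-1) ^+ (dsum d 0 n.-2 * dsum e 0 n.-1)%N *:
        l (alpha \o y) (r x z v)
      + \sum_(i < n.-1)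
        ((-1) ^+ (n.-1 - i)%N *
         (-1) ^+ ((dsum d 0 n.-2 + e i) * (dsum e i.+1 n.-1 + c)
                  + dsum d 0 n.-2 * dsum e 0 i)%N) *:
        r (alpha \o omit y i) (alpha z) (mu (snoc_arg x (y i)) v);
  nhplr_r_mu : forall (d : 'I_n.-1 -> bool) (e : 'I_n.-2 -> bool) (c : bool)
      (x : 'I_n.-1 -> A) (y : 'I_n.-2 -> A) (z : A) (v : V),
    homogs d x -> homogs e y -> homog c z ->
    r (alpha \o y) (alpha z) (mu x v) =
      (-1) ^+ (dsum d 0 n.-1 * (dsum e 0 n.-2 + c))%N *:
        (l (alpha \o x) (r y z v)
         + \sum_(i < n.-1)
             ((-1) ^+ i.+1 * (-1) ^+ (d i * dsum d i.+1 n.-1)%N) *: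
             r (alpha \o omit x i) (br (cons_arg (x i) y) z) (alphaV v))
}.

End NHomPreLieRep.

Section PhiConstruction.
Variables (K : fieldType) (n : nat) (A V : superType K).
Variables (mul : A -> A -> A) (l r : A -> V -> V).
Variable Phi : ('I_n.-2 -> A) -> K.

Definition brPhi (x : 'I_n.-1 -> A) (z : A) : A := hext (fun d x =>
  \sum_(k < n.-1) ((-1) ^+ k * (-1) ^+ (d k * dsum d k.+1 n.-1)%N *
                   Phi (omit x k)) *: mul (x k) z) x.

Definition lPhi (x : 'I_n.-1 -> A) (v : V) : V := hext (fun d x =>
  \sum_(k < n.-1) ((-1) ^+ k * (-1) ^+ (d k * dsum d k.+1 n.-1)%N *
                   Phi (omit x k)) *: l (x k) v) x.

Definition rPhi (x : 'I_n.-2 -> A) (z : A) (v : V) : V := Phi x *: r z v.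

End PhiConstruction.

(* Main.v *)
(** With [D x = sum_k (-1)^k (+-) Phi(.., x_k omitted, ..) x_k], the
    structure maps are [{x, z}_Phi = D x o z], [l_Phi x = l (D x)] and
    [mu x = (l - r) (D x)]. Conditions (i) and (iii) say that [Phi] vanishes as
    soon as one argument is a product or a value of [D], and then
    [D (.., w, ..) = +- Phi(..) w] for such an argument [w]; (ii) makes [D]
    commute with [alpha]. So [x, D y]^C is the binary commutator of [D x] and
    [D y], and the axioms reduce to identities of the binary structures at
    [D x], [D y]. The axioms involving [x_1, .., x_n]^C are about sums
    [sum_i +- B (D (x without x_i)) x_i] with [B] bilinear. Exchanging the two
    omitted indices turns such a sum into the opposite of the same sum for the
    flipped [B], so it vanishes when [B] is supersymmetric (here
    characteristic 2 is excluded) or kills [D] in its second argument. *)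

Require Import Defs.
From HB Require Import structures.
From mathcomp Require Import all_boot all_order all_algebra all_fingroup.
From mathcomp Require Import zify ring.
From Stdlib Require Import FunctionalExtensionality.

Set Implicit Arguments.
Unset Strict Implicit.
Unset Printing Implicit Defensive.

Import GRing.Theory.
Local Open Scope ring_scope.

Section LinearMaps.
Variables (K : fieldType) (U W : lmodType K) (f : U -> W).
Hypothesis f_linear : linear f.

Lemma linear_bundle : {g : {linear U -> W} | g =1 f}.
Proof.
pose L := GRing.isLinear.Build K U W *:%R f f_linear.
pose g : {linear U -> W} := HB.pack f L.
by exists g.
Qed.

Lemma lin0 : f 0 = 0.
Proof. by case: linear_bundle => g <-; apply: linear0. Qed.

Lemma linD u v : f (u + v) = f u + f v.
Proof. by case: linear_bundle => g E; rewrite -!E linearD. Qed.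

Lemma linB u v : f (u - v) = f u - f v.
Proof. by case: linear_bundle => g E; rewrite -!E linearB. Qed.

Lemma linN u : f (- u) = - f u.
Proof. by case: linear_bundle => g E; rewrite -!E linearN. Qed.

Lemma linZ a u : f (a *: u) = a *: f u.
Proof. by case: linear_bundle => g E; rewrite -!E linearZ. Qed.

Lemma lin_sum I (s : seq I) (P : pred I) (F : I -> U) :
  f (\sum_(i <- s | P i) F i) = \sum_(i <- s | P i) f (F i).
Proof.
by case: linear_bundle => g E; rewrite -E linear_sum; apply: eq_bigr => i _.
Qed.

Lemma lin_sumZ I (s : seq I) (P : pred I) (c : I -> K) (F : I -> U) :
  f (\sum_(i <- s | P i) c i *: F i) = \sum_(i <- s | P i) c i *: f (F i).
Proof. by rewrite lin_sum; apply: eq_bigr => i _; rewrite linZ. Qed.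

End LinearMaps.

Section LinearClosure.
Variables (K : fieldType) (U W X : lmodType K).

Lemma linear_comp_fun (g : W -> X) (f : U -> W) :
  linear g -> linear f -> linear (fun u => g (f u)).
Proof. by move=> gl fl a u v; rewrite fl gl. Qed.

Lemma linear_scale_fun c (f : U -> W) : linear f -> linear (fun u => c *: f u).
Proof. by move=> fl a u v; rewrite fl scalerDr !scalerA mulrC. Qed.

Lemma linear_sub_fun (f g : U -> W) :
  linear f -> linear g -> linear (fun u => f u - g u).
Proof.
by move=> fl gl a u v; rewrite fl gl scalerBr opprD addrACA.
Qed.

Lemma linear_scale_const (f : U -> K) (w : W) :
  @linear_for K U K^o *%R f -> linear (fun u => f u *: w).
Proof. by move=> fl a u v; rewrite fl scalerDl scalerA. Qed.

End LinearClosure.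

Section TupleLemmas.
Variables (T : Type) (n : nat).
Implicit Types (x : 'I_n -> T) (i k : 'I_n).

Lemma set_arg_same x i a : set_arg x i a i = a.
Proof. by rewrite /set_arg eqxx. Qed.

Lemma set_arg_id x i : set_arg x i (x i) = x.
Proof.
by apply: functional_extensionality => j; rewrite /set_arg; case: eqP => // ->.
Qed.

Lemma omit_set_arg x k a : omit (set_arg x k a) k = omit x k.
Proof.
apply: functional_extensionality => j.
by rewrite /omit /set_arg eq_sym (negbTE (neq_lift _ _)).
Qed.

Lemma omit_set_arg_lift x k (j : 'I_n.-1) a :
  omit (set_arg x (lift k j) a) k = set_arg (omit x k) j a.
Proof.
apply: functional_extensionality => c.
by rewrite /omit /set_arg (inj_eq (@lift_inj _ k)).
Qed.

Lemma comp_set_arg U (f : T -> U) x i a :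
  f \o set_arg x i a = set_arg (f \o x) i (f a).
Proof.
by apply: functional_extensionality => j; rewrite /= /set_arg; case: eqP.
Qed.

Lemma snoc_arg_max (x : 'I_n -> T) (a : T) : 
  @snoc_arg T n.+1 x a ord_max = a.
Proof. by rewrite /snoc_arg insubF //= ltnn. Qed.

Lemma snoc_arg_widen (x : 'I_n -> T) (a : T) (h : (n <= n.+1)%N) i :
  @snoc_arg T n.+1 x a (widen_ord h i) = x i.
Proof.
rewrite /snoc_arg; have -> : insub (val (widen_ord h i)) = Some i.
  by rewrite /= valK.
by [].
Qed.

Lemma cons_arg_lift (x : 'I_n -> T) (a : T) i :
  @cons_arg T n.+1 a x (lift ord0 i) = x i.
Proof.
by rewrite /cons_arg lift0 /= valK.
Qed.

Lemma omit_cons (x : 'I_n -> T) (a : T) :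
  omit (@cons_arg T n.+1 a x) ord0 = x.
Proof. by apply: functional_extensionality => i; apply: cons_arg_lift. Qed.

Lemma omit_snoc (x : 'I_n -> T) (a : T) :
  omit (@snoc_arg T n.+1 x a) ord_max = x.
Proof.
apply: functional_extensionality => i; rewrite /omit.
have -> : lift (ord_max : 'I_n.+1) i = widen_ord (leqnSn n) i.
  by apply: val_inj; rewrite /= /bump leqNgt ltn_ord.
exact: snoc_arg_widen.
Qed.

End TupleLemmas.

Section MoreTuples.
Variables (T : Type) (n : nat).

Lemma omit_snoc_widen (x : 'I_n.+1 -> T) (a : T) (i : 'I_n.+1) :
  omit (@snoc_arg T n.+2 x a) (widen_ord (leqnSn n.+1) i) =
  @snoc_arg T n.+1 (omit x i) a.
Proof.
apply: functional_extensionality => j; rewrite /omit.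
have := ltn_ord j; rewrite ltnS leq_eqVlt => /orP[/eqP jn|jn].
  have -> : j = ord_max by apply: val_inj.
  rewrite snoc_arg_max.
  have -> : lift (widen_ord (leqnSn n.+1) i) (ord_max : 'I_n.+1) = ord_max.
    by apply: val_inj; rewrite /= /bump -ltnS ltn_ord.
  by rewrite snoc_arg_max.
have -> : j = widen_ord (leqnSn n) (Ordinal jn) by apply: val_inj.
rewrite snoc_arg_widen.
have -> : lift (widen_ord (leqnSn n.+1) i) (widen_ord (leqnSn n) (Ordinal jn))
  = widen_ord (leqnSn n.+1) (lift i (Ordinal jn)) by apply: val_inj.
by rewrite snoc_arg_widen.
Qed.

Lemma set_arg_max (x : 'I_n.+1 -> T) (a : T) :
  set_arg x ord_max a = @snoc_arg T n.+1 (omit x ord_max) a.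
Proof.
apply: functional_extensionality => j; rewrite /set_arg.
case: (unliftP ord_max j) => [k ->|->]; last by rewrite eqxx snoc_arg_max.
rewrite eq_sym (negbTE (neq_lift _ _)) /omit.
have -> : lift (ord_max : 'I_n.+1) k = widen_ord (leqnSn n) k.
  by apply: val_inj; rewrite /= /bump leqNgt ltn_ord.
rewrite snoc_arg_widen; congr x.
by apply: val_inj; rewrite /= /bump leqNgt ltn_ord.
Qed.

Lemma set_arg_ord0 (x : 'I_n.+1 -> T) (a : T) :
  set_arg x ord0 a = @cons_arg T n.+1 a (omit x ord0).
Proof.
apply: functional_extensionality => j; rewrite /set_arg.
case: (unliftP ord0 j) => [k ->|->]; last by rewrite eqxx.
by rewrite eq_sym (negbTE (neq_lift _ _)) !cons_arg_lift.
Qed.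

End MoreTuples.

Lemma sign_eq (R : pzRingType) (a b : nat) :
  odd a = odd b -> (-1) ^+ a = (-1) ^+ b :> R.
Proof. by move=> h; rewrite -signr_odd h signr_odd. Qed.

Section Degrees.
Variable m : nat.
Implicit Types (d : 'I_m -> bool) (i : 'I_m).

Lemma dsum_total d : dsum d 0 m = (\sum_i d i)%N.
Proof. by apply: eq_bigl => i; rewrite ltn_ord. Qed.

Lemma dsum_tail d a : dsum d a.+1 m = (\sum_(i < m | a < i) d i)%N.
Proof. by apply: eq_bigl => i; rewrite ltn_ord andbT. Qed.

Lemma dsum_omit d i : dsum d 0 m = (d i + dsum (omit d i) 0 m.-1)%N.
Proof.
rewrite dsum_total (bigD1_ord i) //=; congr addn.
by rewrite /dsum; apply: eq_bigl => j; rewrite ltn_ord.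
Qed.

Lemma dsum_split d i : 
  dsum d 0 m = (dsum d 0 i + d i + dsum d i.+1 m)%N.
Proof.
rewrite dsum_total dsum_tail (bigID (fun j : 'I_m => j < i)%N) /=.
rewrite -addnA; congr addn; rewrite (bigD1 i) ?ltnn //=; congr addn.
by apply: eq_bigl => j; rewrite -leqNgt ltn_neqAle eq_sym andbC.
Qed.

End Degrees.

Lemma dsum_lift m (d : 'I_m -> bool) (i : 'I_m) (j : 'I_m.-1) :
  dsum d (lift i j).+1 m =
  (dsum (omit d i) j.+1 m.-1 + (j < i) * d i)%N.
Proof.
rewrite !dsum_tail.
have lti : (lift i j < i)%N = (j < i)%N.
  by rewrite /= /bump; case: leqP; lia.
have ltj (k : 'I_m.-1) : (lift i j < lift i k)%N = (j < k)%N.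
  by rewrite !ltnNge leq_bump2.
rewrite big_mkcond (bigD1_ord i) //= lti addnC; congr addn.
  by rewrite [RHS]big_mkcond; apply: eq_bigr => k _; rewrite ltj.
by case: ltnP; rewrite ?mul1n.
Qed.

Section Homogeneous.
Variables (K : fieldType) (A : superType K).
Implicit Types (u v : A) (d e : bool).

Lemma hpart_homog d e v : homog e v -> hpart d v = if d == e then v else 0.
Proof. by move=> <-; rewrite hpartK. Qed.

Lemma homog_hpart d v : homog d (hpart d v).
Proof. by rewrite /homog hpartK eqxx. Qed.

Lemma homog0 d : homog d (0 : A).
Proof. by rewrite /homog (lin0 (hpart_linear d)). Qed.

Lemma homogD d u v : homog d u -> homog d v -> homog d (u + v).
Proof. by rewrite /homog (linD (hpart_linear d)) => -> ->. Qed.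

Lemma homogZ d a v : homog d v -> homog d (a *: v).
Proof. by rewrite /homog (linZ (hpart_linear d)) => ->. Qed.

Lemma homogZ_if d a v : (a != 0 -> homog d v) -> homog d (a *: v).
Proof.
have [->|_] := eqVneq a 0; first by rewrite scale0r => _; apply: homog0.
by move=> h; apply: homogZ; apply: h.
Qed.

Lemma homog_sum d I (s : seq I) (P : pred I) (F : I -> A) :
  (forall i, P i -> homog d (F i)) -> homog d (\sum_(i <- s | P i) F i).
Proof.
by move=> h; apply: big_ind => //; [apply: homog0 | apply: homogD].
Qed.

Lemma hpart_sumb v : v = \sum_(b : bool) hpart b v.
Proof. by rewrite big_bool /= addrC hpart_sum. Qed.

Lemma homogs_snoc n (d : 'I_n -> bool) c (x : 'I_n -> A) a :
  homogs d x -> homog c a ->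
  homogs (@snoc_arg _ n.+1 d c) (@snoc_arg _ n.+1 x a).
Proof.
move=> hx ha i; case: (unliftP ord_max i) => [k ->|->]; last first.
  by rewrite !snoc_arg_max.
have -> : lift (ord_max : 'I_n.+1) k = widen_ord (leqnSn n) k.
  by apply: val_inj; rewrite /= /bump leqNgt ltn_ord.
by rewrite !snoc_arg_widen.
Qed.

Lemma homogs_cons n (d : 'I_n -> bool) c (x : 'I_n -> A) a :
  homogs d x -> homog c a ->
  homogs (@cons_arg _ n.+1 c d) (@cons_arg _ n.+1 a x).
Proof.
move=> hx ha i; case: (unliftP ord0 i) => [k ->|->] //.
by rewrite !cons_arg_lift.
Qed.

Lemma homogs_set m (d : 'I_m -> bool) c (x : 'I_m -> A) a i :
  homogs d x -> homog c a -> homogs (set_arg d i c) (set_arg x i a).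
Proof. by move=> hx ha j; rewrite /set_arg; case: eqP. Qed.

Lemma homogs_omit m (d : 'I_m -> bool) (x : 'I_m -> A) i :
  homogs d x -> homogs (omit d i) (omit x i).
Proof. by move=> hx j; apply: hx. Qed.

End Homogeneous.

Section Multilinear.
Variables (K : fieldType) (A : superType K) (m : nat).

Lemma multilinear0 (W : lmodType K) (f : ('I_m -> A) -> W) x i :
  multilinear f -> x i = 0 -> f x = 0.
Proof. by move=> fl h; rewrite -(set_arg_id x i) h; apply: (lin0 (fl x i)). Qed.

Lemma multilinear_homog0 (W : lmodType K) (f : ('I_m -> A) -> W) :
  multilinear f -> (forall d x, homogs d x -> f x = 0) -> forall x, f x = 0.
Proof.
move=> fl h x.
suff H k (d : 'I_m -> bool) y :
    (forall i : 'I_m, (k <= i)%N -> homog (d i) (y i)) -> f y = 0.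
  by apply: (H m (fun=> false)) => i; rewrite leqNgt ltn_ord.
elim: k d y => [|k IH] d y hy; first by apply: h => i; apply: hy.
have [km|mk] := ltnP k m; last first.
  by apply: (IH d) => i ki; have := ltn_ord i; lia.
pose i := Ordinal km.
rewrite -(set_arg_id y i) (hpart_sumb (y i)) (lin_sum (fl y i)) big1 // => b _.
apply: (IH (set_arg d i b)) => j kj; rewrite /set_arg.
case: eqP => [_|/eqP ji]; first exact: homog_hpart.
by apply: hy; rewrite ltn_neqAle kj andbT eq_sym; apply: ji.
Qed.

Lemma multilinear_homog_ext (W : lmodType K) (f g : ('I_m -> A) -> W) :
  multilinear f -> multilinear g ->
  (forall d x, homogs d x -> f x = g x) -> f =1 g.
Proof.
move=> fl gl h x; apply/eqP; rewrite -subr_eq0; apply/eqP.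
apply: (multilinear_homog0 (f := fun x => f x - g x)) => [y i a u v | d y hy].
  by rewrite fl gl scalerBr opprD addrACA.
by rewrite (h d) // subrr.
Qed.

Lemma multilinear_lin (U W : lmodType K) (f : ('I_m -> A) -> U) (g : U -> W) :
  multilinear f -> linear g -> multilinear (fun x => g (f x)).
Proof. by move=> fl gl x i a u v; rewrite fl gl. Qed.

Lemma multilinear_comp (B : superType K) (W : lmodType K)
    (f : ('I_m -> A) -> W) (g : B -> A) :
  multilinear f -> linear g -> multilinear (fun x : 'I_m -> B => f (g \o x)).
Proof. by move=> fl gl x i a u v; rewrite !comp_set_arg gl fl. Qed.

Lemma hext_homog (W : lmodType K) (F : ('I_m -> bool) -> ('I_m -> A) -> W) d x :
  (forall e, multilinear (F e)) -> homogs d x -> hext F x = F d x.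
Proof.
move=> Fl hx; rewrite /hext (bigD1 [ffun i => d i]) //= big1 => [|e ne].
  rewrite addr0; congr F; apply: functional_extensionality => i.
    by rewrite ffunE.
  by rewrite ffunE hx.
have [i ei] : exists i, e i != d i.
  apply/existsP; rewrite -negb_forall; apply: contra ne => /forallP h.
  by apply/eqP/ffunP => i; rewrite ffunE; apply/eqP.
by rewrite (multilinear0 (i := i)) // (hpart_homog _ (hx i)) (negbTE ei).
Qed.

Lemma multilinear_hext (W : lmodType K)
    (F : ('I_m -> bool) -> ('I_m -> A) -> W) :
  (forall e, multilinear (F e)) -> multilinear (hext F).
Proof.
move=> Fl x i a u v; rewrite /hext scaler_sumr -big_split /=.
apply: eq_bigr => d _.
have E w : (fun j => hpart (d j) (set_arg x i w j)) =
    set_arg (fun j => hpart (d j) (x j)) i (hpart (d i) w).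
  apply: functional_extensionality => j; rewrite /set_arg.
  by case: eqP => // ->.
by rewrite !E hpart_linear Fl.
Qed.

Lemma hext_lin (U W : lmodType K) (F : ('I_m -> bool) -> ('I_m -> A) -> U)
    (g : U -> W) x :
  linear g -> g (hext F x) = hext (fun d x => g (F d x)) x.
Proof. by move=> gl; rewrite /hext (lin_sum gl). Qed.

Lemma multilinear_omit (W : lmodType K) (c : 'I_m -> K)
    (G : ('I_m.-1 -> A) -> A -> W) :
  (forall a, multilinear (G^~ a)) -> (forall u, linear (G u)) ->
  multilinear (fun x => \sum_k c k *: G (omit x k) (x k)).
Proof.
move=> G1 G2 x i a u v; rewrite scaler_sumr -big_split /=.
apply: eq_bigr => k _.
have [ik|] := eqVneq k i.
  rewrite ik !omit_set_arg /set_arg eqxx G2 scalerDr !scalerA.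
  by rewrite (mulrC a).
case: (unliftP k i) => [j ->|->]; last by rewrite eqxx.
move=> nk; rewrite !omit_set_arg_lift {2 4 6}/set_arg (negbTE nk) G1.
by rewrite scalerDr !scalerA (mulrC a).
Qed.

End Multilinear.

Definition omit_sign (K : fieldType) m (d : 'I_m -> bool) (k : 'I_m) : K :=
  (-1) ^+ k * (-1) ^+ (d k * dsum d k.+1 m)%N.

Section PairSwap.
Variable m : nat.

(* Omitting i and then the j-th remaining index removes {i, lift i j}; the     *)
(* image of (i, j) removes the same two indices in the opposite order.        *)
Definition pair_swap (ij : 'I_m.+1 * 'I_m) : 'I_m.+1 * 'I_m :=
  (lift ij.1 ij.2, odflt ij.2 (unlift (lift ij.1 ij.2) ij.1)).

Lemma lift_pair_swap ij : lift (pair_swap ij).1 (pair_swap ij).2 = ij.1.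
Proof.
case: ij => i j /=; case: (unliftP (lift i j) i) => [k <-|/esym/eqP] //=.
by rewrite eq_sym (negbTE (neq_lift _ _)).
Qed.

Lemma pair_swapK : involutive pair_swap.
Proof.
move=> ij; rewrite [LHS]surjective_pairing [in RHS](surjective_pairing ij).
by rewrite {1 2}/pair_swap /= lift_pair_swap /= liftK.
Qed.

Lemma val_pair_swap ij : (pair_swap ij).2 = unbump ij.2 ij.1 :> nat.
Proof.
have := congr1 val (lift_pair_swap ij); case: ij => i j.
rewrite [(pair_swap _).1]/= /= => /(congr1 (unbump (bump i j))).
rewrite bumpK => ->; rewrite /unbump /bump; lia.
Qed.

Lemma omit_pair_swap T (x : 'I_m.+1 -> T) ij :
  omit (omit x (pair_swap ij).1) (pair_swap ij).2 = omit (omit x ij.1) ij.2.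
Proof.
apply: functional_extensionality => k; congr x; apply: val_inj => /=.
by rewrite val_pair_swap -bumpC.
Qed.

Lemma omit_sign_pair_swap (K : fieldType) (d : 'I_m.+1 -> bool) ij :
  let kl := pair_swap ij in
  omit_sign K d kl.1 * omit_sign K (omit d kl.1) kl.2 =
  - (omit_sign K d ij.1 * omit_sign K (omit d ij.1) ij.2 *
     (-1) ^+ (d ij.1 * d (lift ij.1 ij.2))%N).
Proof.
move=> kl.
have E (i : 'I_m.+1) (j : 'I_m) :
  omit_sign K d i * omit_sign K (omit d i) j =
  (-1) ^+ (i + d i * dsum d i.+1 m.+1 + j
           + d (lift i j) * (dsum d (lift i j).+1 m.+1 + (j < i) * d i))%N.
  rewrite /omit_sign -!exprD; apply: sign_eq.
  rewrite dsum_lift /= /omit !(oddD, oddM).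
  by case: (odd i); case: (odd j); case: (d i); case: (d _);
    case: (odd (dsum _ _ _)); case: (odd (dsum _ _ _)); case: (j < i)%N.
rewrite !E -[RHS]mulN1r -!exprD -exprS; apply: sign_eq.
rewrite /kl lift_pair_swap val_pair_swap; case: ij @kl => i j _ /=.
rewrite !(oddD, oddM) !oddb /=.
have -> : odd (unbump j i) = (j < i)%N (+) odd i.
  rewrite /unbump; case: ltnP => h; last by rewrite subn0.
  by rewrite (oddB (leq_trans _ h)) /= ?addbT.
have -> : (unbump j i < bump i j)%N = (i <= j)%N.
  by rewrite /unbump /bump; lia.
rewrite leqNgt.
by case: (j < i)%N; case: (odd i); case: (odd j); case: (d i);
  case: (d _); case: (odd (dsum _ _ _)); case: (odd (dsum _ _ _)).
Qed.

End PairSwap.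

Section SwapTransfer.
Variables (K : fieldType) (A : superType K) (m : nat).
Variable Phi : ('I_m -> A) -> K.
Hypothesis Phi_skew : @super_skew K m A K^o Phi.

Lemma slot_transfer (c : bool) (w w' : A) (i j : 'I_m) :
  homog c w -> homog c w' -> (j = i.+1 :> nat) ->
  (forall d x, homogs d x -> Phi (set_arg x i w) = Phi (set_arg x i w')) <->
  (forall d x, homogs d x -> Phi (set_arg x j w) = Phi (set_arg x j w')).
Proof.
move=> hw hw' ij.
have S (a b : 'I_m) d x u : homogs d x -> homog c u ->
    (a = i /\ b = j) \/ (a = j /\ b = i) ->
    Phi (set_arg x a u) = - ((-1) ^+ (set_arg d a c i * set_arg d a c j)%N *
       Phi (set_arg (fun k => x (tperm i j k)) b u)).
  move=> hx hu ab.
  have -> : set_arg (fun k => x (tperm i j k)) b u =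
      fun k => set_arg x a u (tperm i j k).
    apply: functional_extensionality => k; rewrite /set_arg.
    have -> : (tperm i j k == a) = (k == b) => //.
    rewrite -(inj_eq (@perm_inj _ (tperm i j))) tpermK.
    by case: ab => -[-> ->]; rewrite ?tpermL ?tpermR.
  have -> : Phi (fun k => set_arg x a u (tperm i j k)) =
      - ((-1) ^+ (set_arg d a c i * set_arg d a c j)%N * Phi (set_arg x a u)).
    exact: (Phi_skew (homogs_set a hx hu) ij).
  by rewrite mulrN opprK mulrA -exprD addnn -mul2n exprM sqrrN
    !expr1n mul1r.
have H (a b : 'I_m) : (a = i /\ b = j) \/ (a = j /\ b = i) ->
  (forall d x, homogs d x -> Phi (set_arg x a w) = Phi (set_arg x a w')) ->
  (forall d x, homogs d x -> Phi (set_arg x b w) = Phi (set_arg x b w')).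
  move=> ab h d x hx.
  have ba : (b = i /\ a = j) \/ (b = j /\ a = i) by case: ab => -[-> ->]; tauto.
  rewrite !(S b a d x _ hx) // (h (fun k => d (tperm i j k))) //.
by split; apply: H; [left | right].
Qed.

Lemma slot_transfer_all (c : bool) (w w' : A) (i j : 'I_m) :
  homog c w -> homog c w' -> 
  (forall d x, homogs d x -> Phi (set_arg x i w) = Phi (set_arg x i w')) ->
  (forall d x, homogs d x -> Phi (set_arg x j w) = Phi (set_arg x j w')).
Proof.
move=> hw hw'.
pose P (k : 'I_m) :=
  forall d x, homogs d x -> Phi (set_arg x k w) = Phi (set_arg x k w').
have m0 : (0 < m)%N by apply: leq_ltn_trans (ltn_ord i).
suff H k : P k <-> P (Ordinal m0).
  by move=> h; apply/(H j)/(H i).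
case: k => k; elim: k => [|k IH] km.
  by have -> : Ordinal km = Ordinal m0 by apply: val_inj.
have km' := ltnW km.
by rewrite -(IH km'); apply: iff_sym; apply: slot_transfer hw hw' _.
Qed.

End SwapTransfer.

Section AdjacentSwap.
Variables (m : nat) (i j : 'I_m.+1).
Hypothesis ij : j = i.+1 :> nat.
Let t := tperm i j.

Lemma omit_tpermR T (x : 'I_m.+1 -> T) : omit (fun k => x (t k)) j = omit x i.
Proof.
apply: functional_extensionality => c; rewrite /omit; congr x.
rewrite /t; case: tpermP => [/(congr1 val)|/(congr1 val)|/eqP h1 /eqP h2].
- by move=> h; apply: val_inj; move: h; rewrite /= /bump; lia.
- by move=> h; move: (neq_lift j c); rewrite -val_eqE h eqxx.
apply: val_inj; move: h1 h2; rewrite -!val_eqE /= /bump; lia.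
Qed.

Lemma omit_tpermL T (x : 'I_m.+1 -> T) : omit (fun k => x (t k)) i = omit x j.
Proof.
rewrite -(omit_tpermR (fun k => x (t k))).
apply: functional_extensionality => c; rewrite /omit; congr x.
by rewrite tpermK.
Qed.

Lemma omit_tperm_neq (k : 'I_m.+1) : k != i -> k != j ->
  exists i' j' : 'I_m, [/\ j' = i'.+1 :> nat, lift k i' = i, lift k j' = j &
    forall T (x : 'I_m.+1 -> T),
      omit (fun k => x (t k)) k = fun c => omit x k (tperm i' j' c)].
Proof.
case: (unliftP k i) => [i' ii|->]; last by rewrite eqxx.
case: (unliftP k j) => [j' jj|->]; last by rewrite eqxx.
move=> _ _; exists i', j'; split => //.
  move: ij; rewrite ii jj /= /bump; lia.
move=> T x; apply: functional_extensionality => c; rewrite /omit; congr x.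
rewrite /t ii jj; case: (tpermP i' j' c) => [->|->|h1 h2].
- by rewrite tpermL.
- by rewrite tpermR.
by rewrite tpermD // (inj_eq lift_inj) eq_sym; apply/eqP.
Qed.

Lemma tail_tpermE (d : 'I_m.+1 -> bool) (a : 'I_m.+1) :
  dsum (fun b => d (t b)) (t a).+1 m.+1 = (\sum_(b | t a < t b) d b)%N.
Proof.
rewrite dsum_tail (reindex_inj (@perm_inj _ t)) /=.
by apply: eq_bigr => b _; rewrite tpermK.
Qed.

Lemma dsum_tperm_neq (d : 'I_m.+1 -> bool) (k : 'I_m.+1) : k != i -> k != j ->
  dsum (fun b => d (t b)) k.+1 m.+1 = dsum d k.+1 m.+1.
Proof.
move=> ki kj; have tk : t k = k by rewrite /t tpermD // eq_sym.
rewrite -{1}tk tail_tpermE dsum_tail tk; apply: eq_bigl => b.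
move: ki kj; rewrite -!val_eqE /= /t; case: tpermP => [->|->|//]; lia.
Qed.

Lemma dsum_tpermR (d : 'I_m.+1 -> bool) :
  dsum d i.+1 m.+1 = (d j + dsum (fun b => d (t b)) j.+1 m.+1)%N.
Proof.
rewrite dsum_tail (bigD1 j) /=; last by rewrite ij.
congr addn; have {2}-> : j = t i by rewrite tpermL.
rewrite tail_tpermE tpermL; apply: eq_bigl => b.
rewrite /t -val_eqE /=; case: tpermP => [->|->|/eqP + /eqP]; lia.
Qed.

Lemma dsum_tpermL (d : 'I_m.+1 -> bool) :
  dsum (fun b => d (t b)) i.+1 m.+1 = (d i + dsum d j.+1 m.+1)%N.
Proof.
rewrite -{1}[i](tpermR i j) tail_tpermE tpermR (bigD1 i) /=; last first.
  by rewrite tpermL ij.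
congr addn; rewrite dsum_tail; apply: eq_bigl => b.
rewrite /t -val_eqE /=; case: tpermP => [->|->|/eqP + /eqP]; try lia.
by rewrite -!val_eqE /=; lia.
Qed.

End AdjacentSwap.

Lemma sum_omit_sign (K : fieldType) m (W : lmodType K) (d : 'I_m -> bool)
    (F : 'I_m -> W) :
  \sum_(i < m) ((-1) ^+ (m.-1 - i)%N * (-1) ^+ (d i * dsum d i.+1 m)%N) *: F i =
  (-1) ^+ m.-1 *: \sum_(i < m) omit_sign K d i *: F i.
Proof.
rewrite scaler_sumr; apply: eq_bigr => i _.
rewrite scalerA mulrA; congr (_ * _ *: _).
rewrite -exprD; apply: sign_eq; rewrite oddD oddB //.
by have := ltn_ord i; lia.
Qed.

Section Contraction.
Variables (K : fieldType) (A : superType K) (p : nat).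
Variable Phi : ('I_p.+1 -> A) -> K.
Hypothesis Phi_linear : @multilinear K p.+1 A K^o Phi.
Hypothesis Phi_skew : @super_skew K p.+1 A K^o Phi.
Hypothesis Phi_even : even_form Phi.

(* [contr x] is the element with {x, z}_Phi = contr x o z. *)
Definition contr (x : 'I_p.+2 -> A) : A :=
  hext (fun (d : 'I_p.+2 -> bool) x =>
    \sum_k omit_sign K d k *: (Phi (omit x k) *: x k)) x.

Lemma Phi_scale_linear (W : lmodType K) (f : A -> W) : linear f ->
  (forall a, multilinear (fun u => Phi u *: f a)) /\
  (forall u, linear (fun a => Phi u *: f a)).
Proof.
move=> fl; split=> [a x i b u v|u b v w]; last first.
  by rewrite fl scalerDr !scalerA mulrC.
have -> : Phi (set_arg x i (b *: u + v)) =
    b * Phi (set_arg x i u) + Phi (set_arg x i v) := Phi_linear x i b u v.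
by rewrite scalerDl scalerA.
Qed.

Lemma contr_multilinear : multilinear contr.
Proof.
apply: multilinear_hext => d.
have id_lin : linear (id : A -> A) by [].
have [h1 h2] := Phi_scale_linear id_lin.
exact: (multilinear_omit (omit_sign K d) h1 h2).
Qed.

Lemma contrE d (x : 'I_p.+2 -> A) : homogs d x ->
  contr x = \sum_k omit_sign K d k *: (Phi (omit x k) *: x k).
Proof.
apply: hext_homog => e; have id_lin : linear (id : A -> A) by [].
have [h1 h2] := Phi_scale_linear id_lin.
exact: (multilinear_omit (omit_sign K e) h1 h2).
Qed.

Lemma lin_contr (W : lmodType K) (f : A -> W) d (x : 'I_p.+2 -> A) :
  linear f -> homogs d x ->
  f (contr x) = \sum_k omit_sign K d k *: (Phi (omit x k) *: f (x k)).
Proof.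
move=> fl hx; rewrite (contrE hx) (lin_sumZ fl); apply: eq_bigr => k _.
by rewrite (linZ fl).
Qed.

Lemma Phi_sign d x a b : homogs d x ->
  (~~ odd (dsum d 0 p.+1) -> odd a = odd b) ->
  (-1) ^+ a * Phi x = (-1) ^+ b * Phi x.
Proof.
move=> hx h; case: (boolP (odd (dsum d 0 p.+1))) => [o|/h /sign_eq-> //].
by rewrite (Phi_even hx o) !mulr0.
Qed.

Lemma Phi_sign1 d x a : homogs d x ->
  (~~ odd (dsum d 0 p.+1) -> odd a = false) -> (-1) ^+ a * Phi x = Phi x.
Proof.
by move=> hx h; rewrite (Phi_sign (b := 0) hx) ?expr0 ?mul1r // => /h ->.
Qed.

Lemma Phi_odd0 d x : homogs d x -> odd (dsum d 0 p.+1) -> Phi x = 0.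
Proof. exact: Phi_even. Qed.

Lemma contr_even d x : homogs d x -> homog (odd (dsum d 0 p.+2)) (contr x).
Proof.
move=> hx; rewrite (contrE hx); apply: homog_sum => k _.
apply: homogZ; apply: homogZ_if => nz.
have e : ~~ odd (dsum (omit d k) 0 p.+1).
  by apply: contra nz => o; rewrite (Phi_odd0 (homogs_omit k hx) o).
rewrite (dsum_omit d k) oddD oddb (negbTE e) addbF.
exact: hx.
Qed.

Lemma contr_comp (f : A -> A) x : linear f -> even_map f ->
  (forall u, Phi (f \o u) = Phi u) -> contr (f \o x) = f (contr x).
Proof.
move=> fl fe fP; apply: (multilinear_homog_ext (f := fun x => contr (f \o x))
  (g := fun x => f (contr x))) => [||d y hy].
- exact: multilinear_comp contr_multilinear fl.
- exact: multilinear_lin contr_multilinear fl.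
have hfy : homogs d (f \o y) by move=> i; apply: fe.
rewrite (contrE hfy) (lin_contr fl hy); apply: eq_bigr => k _.
by rewrite -(fP (omit y k)).
Qed.

Lemma contr_skew : super_skew contr.
Proof.
move=> d x i j hx ij; set t := tperm i j.
have hxt : homogs (fun k => d (t k)) (fun k => x (t k)) by move=> k; apply: hx.
rewrite (contrE hxt) (contrE hx) scaler_sumr -sumrN.
rewrite (reindex_inj (@perm_inj _ t)) /=; apply: eq_bigr => k _.
rewrite tpermK !scalerA -scaleNr -mulNr; congr (_ *: _).
have [ki|ki] := eqVneq k i; [|have [kj|kj] := eqVneq k j].
- rewrite ki tpermL omit_tpermR //; rewrite mulrA; congr (_ * _).
  rewrite /omit_sign tpermR (dsum_tpermR ij) ij mulNr.
  rewrite -[RHS]mulN1r -!exprD -exprS.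
  apply: sign_eq.
  rewrite !(oddS, oddD, oddM, oddb) ?tpermL ?tpermR /= ?(oddD, oddM, oddb).
  by case: (odd i); case: (d i); case: (d j); case: (odd (dsum _ _ _)).
- rewrite kj tpermR omit_tpermL //; rewrite mulrA; congr (_ * _).
  rewrite /omit_sign tpermL (dsum_tpermL ij) ij mulNr.
  rewrite -[RHS]mulN1r -!exprD -exprS.
  apply: sign_eq.
  rewrite !(oddS, oddD, oddM, oddb) ?tpermL ?tpermR /= ?(oddD, oddM, oddb).
  by case: (odd i); case: (d i); case: (d j); case: (odd (dsum _ _ _)).
have [i' [j' [ij' ii jj E]]] := omit_tperm_neq ij ki kj.
have tk : t k = k by rewrite /t tpermD // eq_sym.
rewrite tk E.
have -> : Phi (fun c => omit x k (tperm i' j' c)) =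
    - ((-1) ^+ (omit d k i' * omit d k j')%N * Phi (omit x k)).
  exact: (Phi_skew (homogs_omit k hx) ij').
rewrite /omit_sign tk (dsum_tperm_neq ij) // /omit ii jj; ring.
Qed.

Definition null (w : A) : Prop :=
  forall d x i, homogs d x -> Phi (set_arg x i w) = 0.

Lemma null_lin I (s : seq I) (P : pred I) (c : I -> K) (F : I -> A) :
  (forall i, P i -> null (F i)) -> null (\sum_(i <- s | P i) c i *: F i).
Proof.
move=> h d x i hx.
rewrite (lin_sumZ (Phi_linear x i)) big1 // => j Pj.
by rewrite (h j Pj d) // scaler0.
Qed.

Lemma nullZ a u : null u -> null (a *: u).
Proof.
by move=> h d x i hx; rewrite (linZ (Phi_linear x i)) (h d) ?scaler0.
Qed.

Lemma contr_null d x i : homogs d x -> null (x i) ->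
  contr x = omit_sign K d i *: (Phi (omit x i) *: x i).
Proof.
move=> hx xi; rewrite (contrE hx) (bigD1 i) //= big1 ?addr0 // => k.
case: (unliftP k i) => [j ij|->]; last by rewrite eqxx.
move=> _; rewrite -(set_arg_id (omit x k) j).
have -> : omit x k j = x i by rewrite ij.
rewrite (xi (omit d k)); [by rewrite scale0r scaler0 | by move=> c; apply: hx].
Qed.

Lemma null_contr : 
  (forall d (e : 'I_p.+2 -> bool) (x : 'I_p -> A) y,
    homogs d x -> homogs e y ->
    \sum_k omit_sign K e k * Phi (omit y k) * Phi (@snoc_arg _ p.+1 x (y k))
    = 0)
  -> forall d x, homogs d x -> null (contr x).
Proof.
move=> PP e y hy d x i hx.
have P0 k u : Phi (set_arg u k 0) = 0 := lin0 (Phi_linear u k).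
suff h e' (u : 'I_p.+1 -> A) : homogs e' u ->
    Phi (set_arg u ord_max (contr y)) = Phi (set_arg u ord_max 0).
  rewrite (slot_transfer_all Phi_skew i (contr_even hy) (homog0 A _) h hx).
  exact: P0.
move=> hu; rewrite P0.
have /= -> := lin_contr (Phi_linear u ord_max) hy.
rewrite -[RHS](PP _ _ _ _ (homogs_omit ord_max hu) hy); apply: eq_bigr => k _.
by rewrite set_arg_max scalerA.
Qed.

Lemma contr_pair_swap (W : lmodType K) (B : bool -> A -> A -> W)
    (d : 'I_p.+3 -> bool) x :
  (forall b u, linear (B b u)) -> (forall b v, linear ((B b)^~ v)) ->
  homogs d x ->
  \sum_i omit_sign K d i *:
      B (odd (dsum (omit d i) 0 p.+2)) (contr (omit x i)) (x i)
  = - \sum_i (omit_sign K d i * (-1) ^+ (d i * dsum (omit d i) 0 p.+2)%N) *: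
        B (d i) (x i) (contr (omit x i)).
Proof.
move=> Br Bl hx.
pose S (ij : 'I_p.+3 * 'I_p.+2) :=
  omit_sign K d ij.1 * omit_sign K (omit d ij.1) ij.2.
pose P (ij : 'I_p.+3 * 'I_p.+2) := Phi (omit (omit x ij.1) ij.2).
have odd_P ij : P ij != 0 ->
    odd (dsum (omit d ij.1) 0 p.+2) = d (lift ij.1 ij.2).
  move=> nz; rewrite (dsum_omit _ ij.2) oddD oddb.
  suff /negbTE -> : ~~ odd (dsum (omit (omit d ij.1) ij.2) 0 p.+1).
    by rewrite addbF.
  apply: contra nz => o.
  by rewrite /P (Phi_odd0 (homogs_omit ij.2 (homogs_omit ij.1 hx)) o).
transitivity (\sum_ij (S ij * P ij) *:
    B (d (lift ij.1 ij.2)) (x (lift ij.1 ij.2)) (x ij.1)).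
  transitivity (\sum_i \sum_j (S (i, j) * P (i, j)) *:
    B (d (lift i j)) (x (lift i j)) (x i)); last first.
    by rewrite pair_bigA; apply: eq_bigr => -[i j].
  apply: eq_bigr => i _; rewrite (lin_contr (Bl _ _) (homogs_omit i hx)).
  rewrite scaler_sumr; apply: eq_bigr => j _; rewrite !scalerA -mulrA.
  have [h|/odd_P <- //] := eqVneq (P (i, j)) 0.
  by rewrite [Phi _]h !mulr0 !scale0r.
rewrite (reindex_inj (inv_inj (@pair_swapK _))) /=.
transitivity (- \sum_i \sum_j (S (i, j) * P (i, j) *
    (-1) ^+ (d i * d (lift i j))%N) *: B (d i) (x i) (x (lift i j))).
  rewrite pair_bigA -sumrN; apply: eq_bigr => -[i j] _.
  rewrite lift_pair_swap /S /P omit_sign_pair_swap omit_pair_swap /=.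
  by rewrite mulNr scaleNr mulrAC.
congr (- _); apply: eq_bigr => i _.
rewrite (lin_contr (Br _ _) (homogs_omit i hx)).
rewrite scaler_sumr; apply: eq_bigr => j _; rewrite !scalerA; congr (_ *: _).
have [h|nz] := eqVneq (P (i, j)) 0.
  by rewrite h [Phi _]h !(mulr0, mul0r).
have /= h := odd_P _ nz.
have -> : (-1) ^+ (d i * dsum (omit d i) 0 p.+2) =
    (-1) ^+ (d i * d (lift i j)) :> K.
  by apply: sign_eq; rewrite !oddM !oddb h.
by rewrite /S /P /=; ring.
Qed.

End Contraction.

Section SnocDegrees.
Variable n : nat.

Lemma dsum_snoc (d : 'I_n -> bool) c :
  dsum (@snoc_arg _ n.+1 d c) 0 n.+1 = (dsum d 0 n + c)%N.
Proof.
rewrite !dsum_total big_ord_recr /= snoc_arg_max; congr addn.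
by apply: eq_bigr => i _; rewrite snoc_arg_widen.
Qed.

Lemma dsum_cons_tail (d : 'I_n -> bool) c :
  dsum (@cons_arg _ n.+1 c d) 1 n.+1 = dsum d 0 n.
Proof.
rewrite dsum_total dsum_tail big_mkcond big_ord_recl /= add0n.
by apply: eq_bigr => i _; rewrite cons_arg_lift.
Qed.

Lemma dsum_tail_max (d : 'I_n.+1 -> bool) :
  dsum d (ord_max : 'I_n.+1).+1 n.+1 = 0%N.
Proof.
by rewrite dsum_tail big_pred0 // => i; rewrite ltnNge -ltnS ltn_ord.
Qed.

Lemma dsum_snoc_tail (d : 'I_n -> bool) c (i : 'I_n) :
  dsum (@snoc_arg _ n.+1 d c) i.+1 n.+1 = (dsum d i.+1 n + c)%N.
Proof.
rewrite !dsum_tail big_mkcond big_ord_recr /= snoc_arg_max ltn_ord.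
congr addn; rewrite [RHS]big_mkcond; apply: eq_bigr => k _ /=.
by rewrite snoc_arg_widen.
Qed.

End SnocDegrees.

Lemma comm2E (K : fieldType) (A : superType K) (mul : A -> A -> A) a b x y :
  (forall u, linear (mul u)) -> (forall v, linear (mul^~ v)) ->
  homog a x -> homog b y ->
  comm2 mul x y = mul x y - (-1) ^+ (a * b)%N *: mul y x.
Proof.
move=> mr ml hx hy; congr (_ - _).
rewrite (bigD1 a) //= (bigD1 b) //= hx hy big1 => [|b' /negbTE nb].
  rewrite big1 ?addr0 // => a' /negbTE na; rewrite big1 // => b' _.
  by rewrite (hpart_homog _ hx) na (lin0 (mr _)) scaler0.
by rewrite (hpart_homog _ hy) nb (lin0 (ml _)) scaler0.
Qed.

Section PhiStructure.
Variables (K : fieldType) (A V : superType K) (p : nat).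
Variables (mul : A -> A -> A) (alpha : A -> A).
Hypothesis two_neq0 : 2%:R != 0 :> K.
Hypothesis hA : hom_pre_lie mul alpha.
Variable Phi : ('I_p.+1 -> A) -> K.
Hypothesis Phi_linear : @multilinear K p.+1 A K^o Phi.
Hypothesis Phi_skew : @super_skew K p.+1 A K^o Phi.
Hypothesis Phi_even : even_form Phi.
Hypothesis Phi_mul : forall (d : 'I_p -> bool) (a b : bool)
      (x : 'I_p -> A) (y z : A) (i : 'I_p.+1),
    homogs d x -> homog a y -> homog b z ->
    Phi (@insert_arg A p.+1 x i (mul y z)) = 0.
Hypothesis Phi_alpha : forall (a : A) (x : 'I_p -> A),
    Phi (@cons_arg A p.+1 (alpha a) x) = Phi (@cons_arg A p.+1 a x).
Hypothesis Phi_Phi : forall (d : 'I_p -> bool) (e : 'I_p.+2 -> bool)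
      (x : 'I_p -> A) (y : 'I_p.+2 -> A),
    homogs d x -> homogs e y ->
    \sum_(k < p.+2) (-1) ^+ k * (-1) ^+ (e k * dsum e k.+1 p.+2)%N *
      Phi (omit y k) * Phi (@snoc_arg _ p.+1 x (y k)) = 0.

Let mul_r := hpl_linearr hA.
Let mul_l := hpl_linearl hA.
Let mul_even := hpl_even hA.
Let alpha_lin := hpl_alpha_linear hA.
Let alpha_even := hpl_alpha_even hA.
Local Notation D := (contr Phi).
Local Notation null := (null Phi).

Lemma null_mul a b y z : homog a y -> homog b z -> null (mul y z).
Proof.
move=> hy hz d x i hx; rewrite -[RHS](Phi_mul i (homogs_omit i hx) hy hz).
congr Phi; apply: functional_extensionality => j.
rewrite /set_arg /insert_arg eq_sym; case: (unliftP i j) => [k ->|->].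
  by rewrite (negbTE (neq_lift _ _)).
by rewrite eqxx.
Qed.

Lemma Phi_alphas x : Phi (alpha \o x) = Phi x.
Proof.
have H i d u w c : homogs d u -> homog c w ->
    Phi (set_arg u i (alpha w)) = Phi (set_arg u i w).
  move=> hu hw.
  suff h e (y : 'I_p.+1 -> A) : homogs e y ->
      Phi (set_arg y ord0 (alpha w)) = Phi (set_arg y ord0 w).
    by rewrite (slot_transfer_all Phi_skew i (alpha_even hw) hw h hu).
  by move=> _; rewrite !set_arg_ord0 Phi_alpha.
apply: (multilinear_homog_ext (W := K^o) (f := fun x => Phi (alpha \o x))
  (g := Phi)) => [|//|d y hy].
  exact: multilinear_comp Phi_linear alpha_lin.
pose z k : 'I_p.+1 -> A := fun i => if (i < k)%N then alpha (y i) else y i.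
have -> : alpha \o y = z p.+1.
  by apply: functional_extensionality => i; rewrite /z ltn_ord.
have z0 : z 0%N = y by apply: functional_extensionality.
rewrite -[in RHS]z0; elim: {-2}p.+1 (leqnn p.+1) => // k IH kp.
rewrite -(IH (ltnW kp)); pose i := Ordinal kp.
have hz : homogs d (z k).
  by move=> j; rewrite /z; case: ifP => _ //; apply: alpha_even.
have zi : z k i = y i by rewrite /z /= ltnn.
rewrite -(set_arg_id (z k) i) zi -(H i d (z k) (y i) (d i)) //.
congr Phi; apply: functional_extensionality => j; rewrite /set_arg /z.
case: (eqVneq j i) => [->|]; first by rewrite /= ltnSn.
by rewrite ltnS leq_eqVlt -val_eqE /= => /negbTE ->.
Qed.

Let D_even d x (hx : homogs d x) := contr_even Phi_linear Phi_even hx.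
Let D_null d x (hx : homogs d x) : null (D x) :=
  null_contr Phi_linear Phi_skew Phi_even Phi_Phi hx.

Lemma D_alpha x : D (alpha \o x) = alpha (D x).
Proof.
by apply: (contr_comp Phi_linear x alpha_lin alpha_even) => u; apply: Phi_alphas.
Qed.

Lemma hext_contr (W : lmodType K) (f : A -> W) (x : 'I_p.+2 -> A) : linear f ->
  hext (fun (d : 'I_p.+2 -> bool) x => \sum_(k < p.+2)
    ((-1) ^+ k * (-1) ^+ (d k * dsum d k.+1 p.+2)%N * Phi (omit x k)) *:
      f (x k)) x
  = f (D x).
Proof.
move=> fl; rewrite /contr (hext_lin _ _ fl); apply: eq_bigr => d _.
by rewrite (lin_sumZ fl); apply: eq_bigr => k _; rewrite (linZ fl) scalerA.
Qed.

Lemma brPhiE : @brPhi K p.+3 A mul Phi = fun x z => mul (D x) z.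
Proof.
apply: functional_extensionality => x; apply: functional_extensionality => z.
exact: (hext_contr x (mul_l z)).
Qed.

Local Notation br := (fun x z => mul (D x) z).
Local Notation lie := (@ncomm K p.+3 A br).

Lemma br_multilinear z : multilinear (br^~ z).
Proof. exact: multilinear_lin (contr_multilinear Phi_linear) (mul_l z). Qed.

Lemma br_omit_multilinear (c : 'I_p.+3 -> K) :
  multilinear (fun x : 'I_p.+3 -> A => \sum_k c k *: mul (D (omit x k)) (x k)).
Proof.
exact: (multilinear_omit c (G := br) br_multilinear (fun u => mul_r (D u))).
Qed.

Lemma lie_multilinear : multilinear lie.
Proof. by apply: multilinear_hext => d; apply: br_omit_multilinear. Qed.

Lemma lieE d x : homogs d x ->
  lie x = (-1) ^+ p.+2 *: \sum_i omit_sign K d i *: mul (D (omit x i)) (x i).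
Proof.
move=> hx; rewrite /ncomm (hext_homog _ hx).
  exact: (sum_omit_sign (m := p.+3)).
by move=> e; apply: br_omit_multilinear.
Qed.

Lemma lie_even d x : homogs d x -> homog (odd (dsum d 0 p.+3)) (lie x).
Proof.
move=> hx; rewrite (lieE hx); apply/homogZ/homog_sum => i _; apply: homogZ.
rewrite (dsum_omit d i) oddD oddb addbC.
by apply: mul_even; [exact: D_even (homogs_omit i hx) | exact: hx].
Qed.

Lemma lie_null d x : homogs d x -> null (lie x).
Proof.
move=> hx; rewrite (lieE hx); apply: nullZ => //; apply: null_lin => // i _.
exact: null_mul (D_even (homogs_omit i hx)) (hx i).
Qed.

Lemma D_snoc_null d x c w : homogs d x -> homog c w -> null w ->
  D (@snoc_arg _ p.+2 x w) = (-1) ^+ p.+1 *: (Phi x *: w).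
Proof.
move=> hx hw nw; rewrite (contr_null Phi_linear (i := ord_max)
  (homogs_snoc hx hw)).
  rewrite omit_snoc snoc_arg_max /omit_sign dsum_tail_max muln0 expr0.
  by rewrite mulr1.
by rewrite snoc_arg_max.
Qed.

Lemma D_cons_null d x c w : homogs d x -> homog c w -> null w ->
  D (@cons_arg _ p.+2 w x) = Phi x *: w.
Proof.
move=> hx hw nw; rewrite (contr_null Phi_linear (i := ord0)
  (homogs_cons hx hw)) //.
rewrite omit_cons /omit_sign mul1r scalerA; congr (_ *: _).
rewrite -[RHS]mul1r -(expr0 (-1)); apply: (Phi_sign Phi_even hx) => ev.
by rewrite (@dsum_cons_tail p.+1) oddM (negbTE ev) andbF.
Qed.

Lemma Phi_cons_null (d : 'I_p -> bool) x w :
  homogs d x -> null w -> Phi (@cons_arg _ p.+1 w x) = 0.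
Proof.
move=> hx nw; rewrite -(omit_cons x 0) -set_arg_ord0.
exact: nw (homogs_cons hx (homog0 A false)).
Qed.

Lemma lie_snoc_null d x c w : homogs d x -> homog c w -> null w ->
  lie (@snoc_arg _ p.+3 x w) = comm2 mul (D x) w.
Proof.
move=> hx hw nw; rewrite (lieE (homogs_snoc hx hw)).
rewrite (comm2E mul_r mul_l (D_even hx) hw) big_ord_recr /=.
rewrite snoc_arg_max omit_snoc /omit_sign dsum_tail_max muln0 expr0 mulr1.
rewrite scalerDr scalerA -exprD addnn -mul2n exprM sqrrN expr1n expr1n scale1r.
rewrite addrC; congr (_ + _).
rewrite (lin_contr Phi_linear (mul_r w) hx) scaler_sumr -scaleNr scaler_sumr.
apply: eq_bigr => i _.
rewrite !snoc_arg_widen omit_snoc_widen (D_snoc_null (homogs_omit i hx) hw nw).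
rewrite (linZ (mul_l _)) (linZ (mul_l _)) !scalerA; congr (_ *: _).
rewrite /= dsum_snoc_tail /omit_sign mulnDr [X in _ * (_ * X) * _]exprD.
have E : (-1) ^+ (odd (dsum d 0 p.+2) * c)%N * Phi (omit x i) =
    (-1) ^+ (d i * c)%N * Phi (omit x i).
  apply: (Phi_sign Phi_even (homogs_omit i hx)) => /negbTE ev.
  by rewrite !oddM oddb (dsum_omit d i) oddD ev addbF.
rewrite mulNr [in RHS]mulrCA E exprS.
have q2 : (-1) ^+ p.+1 * (-1) ^+ p.+1 = 1 :> K.
  by rewrite -exprD addnn -mul2n exprM sqrrN expr1n expr1n.
ring: q2.
Qed.

Lemma sum_omit_null0 (W : lmodType K) (B : bool -> A -> A -> W)
    (d : 'I_p.+3 -> bool) x :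
  (forall b u, linear (B b u)) -> (forall b v, linear ((B b)^~ v)) ->
  homogs d x -> (forall i, B (d i) (x i) (D (omit x i)) = 0) ->
  \sum_i omit_sign K d i *:
    B (odd (dsum (omit d i) 0 p.+2)) (D (omit x i)) (x i) = 0.
Proof.
move=> Br Bl hx h; rewrite (contr_pair_swap Phi_linear Phi_even Br Bl hx).
by rewrite big1 ?oppr0 // => i _; rewrite h scaler0.
Qed.

Lemma sum_omit_sym0 (W : lmodType K) (B : A -> A -> W) (d : 'I_p.+3 -> bool) x :
  (forall u, linear (B u)) -> (forall v, linear (B^~ v)) ->
  (forall a b u v, homog a u -> homog b v ->
     B u v = (-1) ^+ (a * b)%N *: B v u) ->
  homogs d x -> \sum_i omit_sign K d i *: B (D (omit x i)) (x i) = 0.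
Proof.
move=> Br Bl Bs hx.
set S := \sum_i _; have SN : S = - S.
  rewrite {1}/S (contr_pair_swap Phi_linear Phi_even (fun=> Br) (fun=> Bl) hx
    (B := fun=> B)).
  congr (- _); apply: eq_bigr => i _.
  rewrite (Bs _ _ _ _ (hx i) (D_even (homogs_omit i hx))) scalerA -mulrA.
  rewrite -exprD (@sign_eq _ _ 0) ?mulr1 //.
  by rewrite oddD !oddM !oddb addbb.
move/eqP: SN; rewrite -addr_eq0 -mulr2n -scaler_nat scaler_eq0.
rewrite (negbTE two_neq0).
by move/eqP.
Qed.

Lemma multilinear_snoc m (W : lmodType K) (f : ('I_m.+1 -> A) -> W) x :
  multilinear f -> linear (fun w => f (@snoc_arg A m.+1 x w)).
Proof.
move=> fl a u v; have := fl (@snoc_arg A m.+1 x 0) ord_max a u v.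
by rewrite !set_arg_max omit_snoc.
Qed.

Lemma multilinear_cons m (W : lmodType K) (f : ('I_m.+1 -> A) -> W) x :
  multilinear f -> linear (fun w => f (@cons_arg A m.+1 w x)).
Proof.
move=> fl a u v; have := fl (@cons_arg A m.+1 0 x) ord0 a u v.
by rewrite !set_arg_ord0 omit_cons.
Qed.

Lemma dsum_set_tail m (e : 'I_m -> bool) i c :
  dsum (set_arg e i c) i.+1 m = dsum e i.+1 m.
Proof.
rewrite !dsum_tail; apply: eq_bigr => k ik; rewrite /set_arg.
by case: eqP ik => // ->; rewrite ltnn.
Qed.

Lemma sum_set_arg_lie (W : lmodType K) (L : A -> W) d e x y : linear L ->
  homogs d x -> homogs e y ->
  \sum_(i < p.+2) (-1) ^+ (dsum d 0 p.+2 * dsum e 0 i)%N *: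
    L (D (set_arg (alpha \o y) i (lie (@snoc_arg _ p.+3 x (y i))))) =
  L (comm2 mul (D x) (D y)).
Proof.
move=> Ll hx hy; rewrite -(lie_snoc_null hx (D_even hy) (D_null hy)).
have fl : linear (fun w => L (lie (@snoc_arg _ p.+3 x w))).
  by move=> a u v; rewrite (multilinear_snoc x lie_multilinear) Ll.
rewrite (lin_contr Phi_linear fl hy); apply: eq_bigr => i _.
have hxi := homogs_snoc hx (hy i).
have hay : homogs e (alpha \o y) by move=> k; apply: alpha_even.
have hs := homogs_set i hay (lie_even hxi).
have nl := lie_null hxi.
rewrite (contr_null Phi_linear hs (i := i)); last by rewrite set_arg_same.
rewrite omit_set_arg (_ : omit (alpha \o y) i = alpha \o omit y i) //.
rewrite Phi_alphas.
rewrite set_arg_same !(linZ Ll) !scalerA; congr (_ *: _).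
rewrite /omit_sign dsum_set_tail set_arg_same dsum_snoc.
rewrite mulrCA -!mulrA; congr (_ * _); rewrite mulrA -exprD.
apply: (Phi_sign Phi_even (homogs_omit i hy)) => ev.
have := dsum_split e i; rewrite (dsum_omit e i) addnAC addnC => /addIn.
move=> h; move: ev; rewrite h !(oddD, oddM, oddb).
by case: (odd (dsum e 0 i)); case: (odd (dsum e i.+1 _)); case: (e i);
  case: (odd (dsum d 0 _)).
Qed.

Lemma scale_sub_split (W : lmodType K) (s c : K) (u v w : W) :
  s *: u - c *: (s *: w) = s *: (u - c *: v) + c *: (s *: (v - w)).
Proof.
by rewrite !scalerBr !scalerA (mulrC c s) addrA subrK.
Qed.

Lemma br_n_hom_pre_lie : n_hom_pre_lie (n := p.+3) br alpha.
Proof.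
split => /=.
- exact: br_multilinear.
- by move=> x; apply: mul_r.
- move=> d c x z hx hz; rewrite oddD oddb.
  exact: mul_even (D_even hx) hz.
- move=> z d x i j hx ij.
  by rewrite (contr_skew Phi_linear Phi_skew hx ij) (linN (mul_l z))
    (linZ (mul_l z)).
- exact: alpha_lin.
- exact: alpha_even.
- move=> d e c x y z hx hy hz.
  rewrite (sum_set_arg_lie (mul_l (alpha z)) hx hy) !D_alpha.
  rewrite (comm2E mul_r mul_l (D_even hx) (D_even hy)).
  have := hpl_ass hA (D_even hx) (D_even hy) hz; rewrite /hom_ass.
  rewrite (@sign_eq _ _ (dsum d 0 p.+2 * dsum e 0 p.+2)%N); last first.
    by rewrite !oddM !oddb.
  rewrite (linB (mul_l _)) (linZ (mul_l _)) scalerBr => /eqP.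
  rewrite subr_eq => /eqP ->.
  by rewrite addrC addrA addrAC.
move=> d e c x y z hx hy hz.
have hay : homogs e (alpha \o y) by move=> k; apply: alpha_even.
rewrite (D_cons_null hay (lie_even hx) (lie_null hx)) Phi_alphas.
rewrite (@sum_omit_sign K p.+3) (lieE hx).
have Dl := multilinear_cons y (contr_multilinear Phi_linear).
rewrite (linZ (mul_l _)) (linZ (mul_l _)) (lin_sumZ (mul_l _)) scalerA mulrC.
rewrite -scalerA; congr (_ *: _); apply/esym/eqP; rewrite -subr_eq0.
rewrite scaler_sumr -sumrB; apply/eqP.
pose B1 (b : bool) u v := mul (alpha u) (mul (D (@cons_arg A p.+2 v y)) z)
  - Phi y *: mul (alpha u) (mul v z).
pose B2 u v := hom_ass mul alpha u v z.
have z_lin : linear (fun v => mul (D (@cons_arg A p.+2 v y)) z).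
  exact: linear_comp_fun (mul_l z) Dl.
have B1r b u : linear (B1 b u).
  apply: linear_sub_fun; first exact: linear_comp_fun (mul_r _) z_lin.
  apply: linear_scale_fun; exact: linear_comp_fun (mul_r _) (mul_l z).
have B1l b v : linear ((B1 b)^~ v).
  apply: linear_sub_fun; first exact: linear_comp_fun (mul_l _) alpha_lin.
  apply: linear_scale_fun; exact: linear_comp_fun (mul_l _) alpha_lin.
have B2r u : linear (B2 u).
  apply: linear_sub_fun; first exact: linear_comp_fun (mul_r _) (mul_l z).
  exact: linear_comp_fun (mul_l _) (mul_r u).
have B2l v : linear (B2^~ v).
  apply: linear_sub_fun; first exact: linear_comp_fun (mul_l _) alpha_lin.
  exact: linear_comp_fun (mul_l _) (mul_l v).
transitivity (\sum_i omit_sign K d i *: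
    B1 (odd (dsum (omit d i) 0 p.+2)) (D (omit x i)) (x i) +
  Phi y *: \sum_i omit_sign K d i *: B2 (D (omit x i)) (x i)).
  rewrite scaler_sumr -big_split; apply: eq_bigr => i _.
  by rewrite D_alpha (scale_sub_split _ _ _
    (mul (alpha (D (omit x i))) (mul (x i) z))).
rewrite (sum_omit_null0 B1r B1l hx) => [|i]; last first.
  have hxi := homogs_omit i hx.
  rewrite /B1 (D_cons_null hy (D_even hxi) (D_null hxi)).
  by rewrite (linZ (mul_l _)) (linZ (mul_r _)) subrr.
rewrite (sum_omit_sym0 B2r B2l _ hx) ?scaler0 ?addr0 // => a b u v hu hv.
by rewrite /B2 (hpl_ass hA hu hv hz).
Qed.

Section Representation.
Variables (l r : A -> V -> V) (alphaV : V -> V).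
Hypothesis hV : hom_pre_lie_rep mul alpha l r alphaV.

Let l_lin := hplr_l_linear hV.
Let l_gl := hplr_l_gl hV.
Let r_lin := hplr_r_linear hV.
Let r_gl := hplr_r_gl hV.
Let alphaV_lin := hplr_alphaV_linear hV.

Local Notation lD := (fun x v => l (D x) v).
Local Notation rP := (@rPhi K p.+3 A V r Phi).

Lemma lPhiE : @lPhi K p.+3 A V l Phi = lD.
Proof.
apply: functional_extensionality => x; apply: functional_extensionality => v.
exact: (hext_contr x (l_lin v)).
Qed.

Lemma muE x v : @mu K p.+3 A V lD rP x v = l (D x) v - r (D x) v.
Proof.
rewrite /mu; congr (_ + _); rewrite -(hext_contr x (r_lin v)) /hext -sumrN.
apply: eq_bigr => d _; rewrite -sumrN; apply: eq_bigr => k _.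
by rewrite /rPhi scalerA exprS !mulN1r !mulNr scaleNr.
Qed.

Lemma r_sub_identity a b x y v : homog a x -> homog b y ->
  r (alpha y) (l x v - r x v) = (-1) ^+ (a * b)%N *:
    (l (alpha x) (r y v) - r (mul x y) (alphaV v)).
Proof.
move=> hx hy; have /eqP := hplr_r hV v hx hy.
rewrite (linB (r_gl _)) scalerBr subr_eq => /eqP ->.
by rewrite opprD addrA opprB addrCA subrr addr0.
Qed.

Lemma l_sub_sym a b x y v : homog a x -> homog b y ->
  l (alpha x) (l y v) - l (mul x y) (alphaV v) =
  (-1) ^+ (a * b)%N *: (l (alpha y) (l x v) - l (mul y x) (alphaV v)).
Proof.
move=> hx hy; have /esym/eqP := hplr_l hV v hx hy.
rewrite (comm2E mul_r mul_l hx hy) (linB (l_lin _)) (linZ (l_lin _)) scalerBr.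
rewrite subr_eq => /eqP ->.
by rewrite addrAC [X in X + _]addrAC subrr add0r addrC.
Qed.

Lemma lD_n_hom_lie_rep : n_hom_lie_rep (n := p.+3) lie alpha lD alphaV.
Proof.
split => /=.
- by move=> v; apply: multilinear_lin (contr_multilinear Phi_linear) (l_lin v).
- by move=> x; apply: l_gl.
- move=> d c x z hx hz; rewrite oddD oddb.
  exact: (hplr_l_even hV (D_even hx) hz).
- move=> v d x i j hx ij.
  by rewrite (contr_skew Phi_linear Phi_skew hx ij) (linN (l_lin v))
    (linZ (l_lin v)).
- exact: alphaV_lin.
- exact: (hplr_alphaV_even hV).
- by move=> x v; rewrite D_alpha (hplr_alphaV_l hV).
- move=> d e x y v hx hy.
  rewrite (sum_set_arg_lie (l_lin _) hx hy) !D_alpha.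
  rewrite (hplr_l hV _ (D_even hx) (D_even hy)).
  by congr (_ - _ *: _); apply: sign_eq; rewrite !oddM !oddb.
move=> d e x y v hx hy.
have hax : homogs d (alpha \o x) by move=> k; apply: alpha_even.
rewrite (D_snoc_null hax (lie_even hy) (lie_null hy)) Phi_alphas.
set X := dsum d 0 p.+1.
transitivity ((-1) ^+ p.+2 *: \sum_i omit_sign K e i *:
   ((-1) ^+ (X * odd (dsum (omit e i) 0 p.+2))%N *:
    l (alpha (D (omit y i))) (l (D (@snoc_arg _ p.+2 x (y i))) v))); last first.
  rewrite -(@sum_omit_sign K p.+3); apply: eq_bigr => i _.
  rewrite -D_alpha scalerA -mulrA -exprD; congr (_ * _ *: _); apply: sign_eq.
  rewrite (dsum_omit e i) !(oddD, oddM, oddb).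
  by case: (odd X); case: (e i); case: (odd (dsum (omit e i) _ _));
    case: (odd (dsum e _ _)).
rewrite (lieE hy) !(linZ (l_lin _)) (lin_sumZ (l_lin _)).
have -> T : (-1) ^+ p.+1 *: (Phi x *: ((-1) ^+ p.+2 *: T)) =
    (-1) ^+ p.+2 *: (((-1) ^+ p.+1 * Phi x) *: T) :> V.
  by rewrite !scalerA; congr (_ *: _); ring.
congr (_ *: _); apply/esym/eqP; rewrite -subr_eq0; apply/eqP.
set c := _ * Phi x; rewrite scaler_sumr -sumrB.
have Dl := multilinear_snoc x (contr_multilinear Phi_linear).
pose B1 (b : bool) u w := (-1) ^+ (X * b)%N *:
    l (alpha u) (l (D (@snoc_arg A p.+2 x w)) v) - c *: l (alpha u) (l w v).
pose B2 u w := l (alpha u) (l w v) - l (mul u w) (alphaV v).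
have B1r b u : linear (B1 b u).
  apply: linear_sub_fun; apply: linear_scale_fun;
    apply: linear_comp_fun (l_gl _) _.
    exact: linear_comp_fun (l_lin v) Dl.
  exact: l_lin.
have B1l b w : linear ((B1 b)^~ w).
  by apply: linear_sub_fun; apply: linear_scale_fun;
    exact: linear_comp_fun (l_lin _) alpha_lin.
have B2r u : linear (B2 u).
  apply: linear_sub_fun; first exact: linear_comp_fun (l_gl _) (l_lin v).
  exact: linear_comp_fun (l_lin _) (mul_r u).
have B2l w : linear (B2^~ w).
  apply: linear_sub_fun; first exact: linear_comp_fun (l_lin _) alpha_lin.
  exact: linear_comp_fun (l_lin _) (mul_l w).
transitivity (\sum_i omit_sign K e i *:
    B1 (odd (dsum (omit e i) 0 p.+2)) (D (omit y i)) (y i) +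
  c *: \sum_i omit_sign K e i *: B2 (D (omit y i)) (y i)).
  rewrite scaler_sumr -big_split; apply: eq_bigr => i _.
  by rewrite (scale_sub_split _ _ _ (l (alpha (D (omit y i))) (l (y i) v))).
rewrite (sum_omit_null0 B1r B1l hy) => [|i]; last first.
  have hyi := homogs_omit i hy.
  rewrite /B1 (D_snoc_null hx (D_even hyi) (D_null hyi)).
  rewrite !(linZ (l_lin _)) !(linZ (l_gl _)) !scalerA.
  have E : (-1) ^+ (X * e i)%N * Phi x = Phi x.
    by apply: (Phi_sign1 Phi_even hx) => ev; rewrite oddM (negbTE ev).
  by rewrite mulrCA E subrr.
rewrite (sum_omit_sym0 B2r B2l _ hy) ?scaler0 ?addr0 // => a b u w hu hw.
by rewrite /B2 (l_sub_sym v hu hw).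
Qed.

Lemma rP_n_hom_pre_lie_rep :
  n_hom_pre_lie_rep (n := p.+3) br alpha lD rP alphaV.
Proof.
split => /=.
- exact: lD_n_hom_lie_rep.
- by move=> z v; apply: (Phi_scale_linear Phi_linear (r_lin v)).1.
- by move=> x v; apply: linear_scale_fun; apply: r_lin.
- by move=> x z; apply: linear_scale_fun; apply: r_gl.
- move=> d b c x z v hx hz hv; apply: homogZ_if => nz.
  have ev : ~~ odd (dsum d 0 p.+1).
    by apply: contra nz => o; rewrite (Phi_odd0 Phi_even hx o).
  rewrite !oddD !oddb (negbTE ev) /=; exact: (hplr_r_even hV hz hv).
- move=> z v d x i j hx ij.
  have -> : rP (fun k => x (tperm i j k)) z v =
      (- ((-1) ^+ (d i * d j)%N * Phi x)) *: r z v.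
    by congr (_ *: _); exact: (Phi_skew hx ij).
  by rewrite scaleNr -scalerA.
- move=> x z v; rewrite /rPhi Phi_alphas (linZ alphaV_lin).
  by rewrite (hplr_alphaV_r hV).
- move=> d e c x y z v hx hy hz.
  rewrite /rPhi muE Phi_alphas D_alpha big1 => [|i _]; last first.
    have hay : homogs e (alpha \o y) by move=> k; apply: alpha_even.
    by rewrite (lie_null (homogs_snoc hx (hy i)) _ hay) scale0r scaler0.
  rewrite addr0 (r_sub_identity v (D_even hx) hz) (linZ (l_gl _)) !scalerA.
  have -> : (-1) ^+ (dsum d 0 p.+2 * (dsum e 0 p.+1 + c))%N * Phi y *
      (-1) ^+ (odd (dsum d 0 p.+2) * c)%N = Phi y.
    rewrite mulrAC -exprD; apply: (Phi_sign1 Phi_even hy) => /negbTE ev.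
    by rewrite oddD !oddM oddD !oddb ev addbb.
  have -> : (-1) ^+ (dsum d 0 p.+2 * dsum e 0 p.+1)%N * Phi y = Phi y.
    by apply: (Phi_sign1 Phi_even hy) => /negbTE ev; rewrite oddM ev andbF.
  by rewrite scalerBr subrK.
- move=> d e c x y z v hx hy hz.
  have hay : homogs e (alpha \o y) by move=> k; apply: alpha_even.
  rewrite /rPhi (Phi_cons_null hay (lie_null hx)) scale0r.
  rewrite (@sum_omit_sign K p.+3).
  have Pl := multilinear_cons y Phi_linear.
  pose B (b : bool) u w := l (alpha u) (Phi (@cons_arg A p.+1 w y) *: r z v).
  transitivity ((-1) ^+ p.+2 *: \sum_i omit_sign K d i *:
      B (odd (dsum (omit d i) 0 p.+2)) (D (omit x i)) (x i)); last first.
    by congr (_ *: _); apply: eq_bigr => i _; rewrite D_alpha.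
  rewrite (sum_omit_null0 _ _ hx) ?scaler0 // => [b u|b w|i].
  + exact: linear_comp_fun (l_gl _) (linear_scale_const _ Pl).
  + exact: linear_comp_fun (l_lin _) alpha_lin.
  rewrite /B (Phi_cons_null hy (D_null (homogs_omit i hx))) scale0r.
  exact: lin0 (l_gl _).
- move=> d e c x y z v hx hy hz; rewrite /rPhi.
  pose f w := r (alpha z) (l (D (@snoc_arg A p.+2 x w)) v -
                           r (D (@snoc_arg A p.+2 x w)) v).
  have Dl := multilinear_snoc x (contr_multilinear Phi_linear).
  have fl : linear f.
    apply: linear_comp_fun (r_gl _) _; apply: linear_sub_fun.
      exact: linear_comp_fun (l_lin v) Dl.
    exact: linear_comp_fun (r_lin v) Dl.
  have fD : f (D y) = ((-1) ^+ p.+1 * Phi x * (-1) ^+ (dsum e 0 p.+2 * c)%N) *: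
      (l (alpha (D y)) (r z v) - r (mul (D y) z) (alphaV v)).
    rewrite /f (D_snoc_null hx (D_even hy) (D_null hy)) scalerA.
    rewrite (linZ (l_lin _)) (linZ (r_lin _)) -scalerBr (linZ (r_gl _)).
    rewrite (r_sub_identity v (D_even hy) hz) scalerA; congr (_ * _ *: _).
    by apply: sign_eq; rewrite !oddM !oddb.
  have -> : \sum_(i < p.+2) ((-1) ^+ (p.+2 - i)%N *
       (-1) ^+ ((dsum d 0 p.+1 + e i) * (dsum e i.+1 p.+2 + c) +
                dsum d 0 p.+1 * dsum e 0 i)%N) *:
       (Phi (alpha \o omit y i) *:
        r (alpha z) (@mu K p.+3 A V lD rP (@snoc_arg _ p.+2 x (y i)) v)) =
    ((-1) ^+ p.+2 * (-1) ^+ ((dsum d 0 p.+1 + dsum e 0 p.+2) * c)%N) *: f (D y).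
    rewrite (lin_contr Phi_linear fl hy) scaler_sumr; apply: eq_bigr => i _.
    rewrite muE Phi_alphas !scalerA; congr (_ *: _).
    rewrite /omit_sign [in RHS]mulrA -!exprD.
    apply: (Phi_sign Phi_even (homogs_omit i hy)) => ev.
    have := dsum_split e i; rewrite (dsum_omit e i) addnAC addnC => /addIn h.
    rewrite !(oddD, oddM, oddb) oddB; last by rewrite ltnW.
    move: ev; rewrite h !oddD !oddS /=.
    by case: (odd (dsum e 0 i)); case: (odd (dsum e i.+1 _)); case: (e i);
      case: (odd (dsum d 0 _)); case: c {hz fD}; case: (odd i); case: (odd p).
  rewrite fD Phi_alphas D_alpha (linZ (l_gl _)) !scalerA.
  have -> : (-1) ^+ (dsum d 0 p.+1 * dsum e 0 p.+2)%N * Phi x = Phi x.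
    by apply: (Phi_sign1 Phi_even hx) => /negbTE ev; rewrite oddM ev.
  have -> : (-1) ^+ p.+2 * (-1) ^+ ((dsum d 0 p.+1 + dsum e 0 p.+2) * c)%N *
      ((-1) ^+ p.+1 * Phi x * (-1) ^+ (dsum e 0 p.+2 * c)%N) = - Phi x.
    rewrite mulrA mulrAC mulrA -!exprD -[RHS]mulN1r -(expr1 (-1)).
    apply: (Phi_sign Phi_even hx) => /negbTE ev.
    rewrite !(oddD, oddM, oddS, oddb) ev.
    by case: (odd p); case: (odd (dsum e 0 _)); case: c {hz fD}.
  by rewrite scaleNr scalerBr opprB addrCA subrr addr0.
move=> d e c x y z v hx hy hz; rewrite /rPhi muE Phi_alphas.
pose f w := r (mul (D (@cons_arg A p.+2 w y)) z) (alphaV v).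
have fl : linear f.
  apply: linear_comp_fun (r_lin _) _; apply: linear_comp_fun (mul_l z) _.
  exact: multilinear_cons y (contr_multilinear Phi_linear).
have -> : \sum_(i < p.+2) ((-1) ^+ i.+1 * (-1) ^+ (d i * dsum d i.+1 p.+2)%N) *:
    (Phi (alpha \o omit x i) *:
      r (mul (D (@cons_arg A p.+2 (x i) y)) z) (alphaV v)) = - f (D x).
  rewrite (lin_contr Phi_linear fl hx) -sumrN; apply: eq_bigr => i _.
  by rewrite Phi_alphas exprS mulN1r mulNr scaleNr.
rewrite /f (D_cons_null hy (D_even hx) (D_null hx)) D_alpha.
rewrite (linZ (mul_l _)) (linZ (r_lin _)) (linZ (l_gl _)) -scalerBr.
rewrite (r_sub_identity v (D_even hx) hz) !scalerA; congr (_ *: _).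
rewrite mulrC; apply: (Phi_sign Phi_even hy) => /negbTE ev.
by rewrite !oddM oddD !oddb ev.
Qed.

End Representation.

End PhiStructure.

Theorem proposition4p5 (K : closedFieldType) (charK : [pchar K] =i pred0)
  (n : nat) (hn : (3 <= n)%N) (A V : superType K)
  (mul : A -> A -> A) (alpha : A -> A)
  (l r : A -> V -> V) (alphaV : V -> V)
  (hA : hom_pre_lie mul alpha)
  (hV : hom_pre_lie_rep mul alpha l r alphaV)
  (Phi : ('I_n.-2 -> A) -> K)
  (Phi_linear : @multilinear K n.-2 A K^o Phi)
  (Phi_skew : @super_skew K n.-2 A K^o Phi)
  (Phi_even : even_form Phi)
  (Phi_mul : forall (d : 'I_n.-2.-1 -> bool) (a b : bool)
      (x : 'I_n.-2.-1 -> A) (y z : A) (i : 'I_n.-2),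
    homogs d x -> homog a y -> homog b z ->
    Phi (insert_arg x i (mul y z)) = 0)
  (Phi_alpha : forall (a : A) (x : 'I_n.-2.-1 -> A),
    Phi (cons_arg (alpha a) x) = Phi (cons_arg a x))
  (Phi_Phi : forall (d : 'I_n.-2.-1 -> bool) (e : 'I_n.-1 -> bool)
      (x : 'I_n.-2.-1 -> A) (y : 'I_n.-1 -> A),
    homogs d x -> homogs e y ->
    \sum_(k < n.-1) (-1) ^+ k * (-1) ^+ (e k * dsum e k.+1 n.-1)%N *
      Phi (omit y k) * Phi (snoc_arg x (y k)) = 0) :
  n_hom_pre_lie (brPhi mul Phi) alpha /\
  n_hom_pre_lie_rep (brPhi mul Phi) alpha (lPhi l Phi) (rPhi r Phi) alphaV.
Proof.
have two_neq0 : 2%:R != 0 :> K.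
  by apply/negP => h; have := charK 2%N; rewrite inE /= h.
move: Phi Phi_linear Phi_skew Phi_even Phi_mul Phi_alpha Phi_Phi.
case: n hn => [|[|[|p]]] // _ Phi Phi_linear Phi_skew Phi_even Phi_mul.
move=> Phi_alpha Phi_Phi.
rewrite (brPhiE hA) (lPhiE Phi hV); split.
  exact: br_n_hom_pre_lie.
exact: rP_n_hom_pre_lie_rep.
Qed.
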